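(* Let $J_1=-\frac12$, $J_2=\frac12+\frac{\sqrt2}{2}$, $J_3=\frac{\sqrt2}{2}$, and let $H=J_1\,\mathbf{s}_2\cdot\mathbf{s}_3+J_2\,\mathbf{s}_3\cdot\mathbf{s}_1+J_3\,\mathbf{s}_1\cdot\mathbf{s}_2$ on $\mathcal{P}=\mathcal{S}^2\times\mathcal{S}^2\times\mathcal{S}^2$. Put $E_0=-1-\sqrt2$, $E_1=0$, $E_2=1$, $E_3=\sqrt2$, $E_4=\frac18(10+\sqrt2)$. Then the normalized density of states of $H$ is supported on $[E_0,E_4]$ and is given by $$D(\varepsilon)=\begin{cases}\dfrac{3}{2\sqrt2}-\dfrac{\sqrt{\frac18(10+\sqrt2)-\varepsilon}}{\sqrt{2+\sqrt2}}, & E_0\le\varepsilon\le E_1,\\[2mm] \sqrt2-1, & E_1\le\varepsilon\le E_2,\\[1mm] \dfrac{\sqrt{\frac18(10+\sqrt2)-\varepsilon}}{\sqrt{2+\sqrt2}}+\dfrac{3}{2\sqrt2}-1, & E_2\le\varepsilon\le E_3,\\[2mm] \sqrt{4-2\sqrt2}\,\sqrt{\tfrac18(10+\sqrt2)-\varepsilon}, & E_3\le\varepsilon\le E_4.\end{cases}$$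
   Context: $\mathcal{S}^2\subset\mathbb{R}^3$ is the unit sphere and $\mathbf{s}_1,\mathbf{s}_2,\mathbf{s}_3\in\mathcal{S}^2$ are the three components of a point $s\in\mathcal{P}$. The normalized density of states of $H$ is the probability density (with respect to Lebesgue measure $d\varepsilon$) of the random variable $H(s)$ when $s$ is distributed according to the normalized product of the surface measures on $\mathcal{P}$, i.e. when $\mathbf{s}_1,\mathbf{s}_2,\mathbf{s}_3$ are independent and uniformly distributed on $\mathcal{S}^2$. *)

(* Defs.v *)
From HB Require Import structures.
From mathcomp Require Import all_boot all_order all_algebra.
From mathcomp Require Import ring.
From mathcomp Require Import all_classical all_reals all_analysis measurable_realfun.

Set Implicit Arguments.
Unset Strict Implicit.
Unset Printing Implicit Defensive.

Import Order.TTheory GRing.Theory Num.Theory.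
Import numFieldNormedType.Exports.

Local Open Scope classical_set_scope.
Local Open Scope ring_scope.

Notation vec3 R := (R * R * R)%type.

Definition dot {R : realType} (u v : vec3 R) : R :=
  u.1.1 * v.1.1 + u.1.2 * v.1.2 + u.2 * v.2.

Definition unit_sphere {R : realType} : set (vec3 R) := [set u | dot u u = 1].

(* p.1 is the polar angle (colatitude) and p.2 the azimuth. *)
Definition sphere_chart {R : realType} (p : R * R) : vec3 R :=
  (sin p.1 * cos p.2, sin p.1 * sin p.2, cos p.1).

Definition sphere_chart_domain {R : realType} : set (R * R) :=
  `[0, pi] `*` `[0, 2 * pi].

(* The surface measure of the sphere, as a Borel measure on R^3: the area
   element of the chart, i.e. the norm of the cross product of its two partial
   derivatives, is sin p.1. The chart is injective up to a null set. *)
Definition sphere_area {R : realType} (A : set (vec3 R)) : \bar R :=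
  (\int[lebesgue_measure \x lebesgue_measure]_(p in
      @sphere_chart_domain R `&` sphere_chart @^-1` A) (sin p.1)%:E)%E.

Definition uniform_sphere {R : realType} (A : set (vec3 R)) : \bar R :=
  (((4 * pi)^-1)%:E * sphere_area A)%E.

Section uniform_sphere_probability.
Context {R : realType}.
Local Notation leb := (@lebesgue_measure R).
Local Notation dom := (@sphere_chart_domain R).

Let measurable_sin : measurable_fun [set: R] (@sin R).
Proof. exact: continuous_measurable_fun (@continuous_sin R). Qed.

Let measurable_cos : measurable_fun [set: R] (@cos R).
Proof. exact: continuous_measurable_fun (@continuous_cos R). Qed.

Lemma measurable_sphere_chart :
  measurable_fun [set: R * R] (@sphere_chart R).
Proof.
apply/measurable_fun_pair => /=; last exact: measurableT_comp.
by apply/measurable_fun_pair => /=; apply: measurable_funM;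
  exact: measurableT_comp.
Qed.

Lemma measurable_sphere_chart_domain : measurable dom.
Proof. by apply: measurableX; exact: measurable_itv. Qed.

Let measurable_dom_preimage (A : set (vec3 R)) : measurable A ->
  measurable (dom `&` sphere_chart @^-1` A).
Proof.
move=> mA; apply: measurableI; first exact: measurable_sphere_chart_domain.
by rewrite -[X in measurable X]setTI; exact: measurable_sphere_chart.
Qed.

Let sin_dom_ge0 (p : R * R) : dom p -> (0 <= (sin p.1)%:E)%E.
Proof.
by move=> [/=]; rewrite in_itv/= => p1 _; rewrite lee_fin sin_ge0_pi.
Qed.

Let measurable_sin1 (D : set (R * R)) :
  measurable_fun D (fun p : R * R => (sin p.1)%:E).
Proof.
apply: measurable_funTS; apply/measurable_EFinP.
exact: measurableT_comp.
Qed.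

Let sphere_area0 : sphere_area (@set0 (vec3 R)) = 0%E.
Proof. by rewrite /sphere_area preimage_set0 setI0 integral_set0. Qed.

Let sphere_area_ge0 (A : set (vec3 R)) : (0 <= sphere_area A)%E.
Proof. by apply: integral_ge0 => p [+ _]; exact: sin_dom_ge0. Qed.

Let sphere_area_sigma_additive : semi_sigma_additive (@sphere_area R).
Proof.
move=> /= F mF tF mUF; rewrite /sphere_area; apply: cvg_toP.
  apply: ereal_nondecreasing_is_cvgn => m n mn.
  by apply: lee_sum_nneg_natr => // k _ _; exact: sphere_area_ge0.
rewrite preimage_bigcup setI_bigcupr ge0_integral_bigcup//=.
- by move=> k; exact: measurable_dom_preimage.
- exact: measurable_sin1.
- by move=> p [k _ [+ _]]; exact: sin_dom_ge0.
- apply/trivIsetP => i j _ _ ij.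
  rewrite setIACA setIid -preimage_setI.
  by move/trivIsetP : tF => /(_ _ _ _ _ ij) ->//; rewrite preimage_set0 setI0.
Qed.

HB.instance Definition _ := isMeasure.Build _ _ _ (@sphere_area R)
  sphere_area0 sphere_area_ge0 sphere_area_sigma_additive.

Lemma integral_sin_0_pi : (\int[leb]_(x in `[0%R, pi]) (sin x)%:E = 2%:E)%E.
Proof.
rewrite (@continuous_FTC2 _ _ (fun x : R => - cos x)).
- by rewrite cospi cos0 -EFinB; congr EFin; ring.
- exact: pi_gt0.
- by apply/continuous_subspaceT => x; exact: continuous_sin.
- have cN (x : R) : {for x, continuous (fun x : R => - cos x)}.
    by apply: continuousN; exact: continuous_cos.
  split.
  + by move=> x _; exact: derivableN.
  + exact/cvg_at_right_filter/cN.
  + exact/cvg_at_left_filter/cN.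
- move=> x _; rewrite derive1E.
  by rewrite (@derive_val _ _ _ _ _ _ _ (is_deriveN (is_derive_cos x))) opprK.
Qed.

Lemma sphere_area_setT : sphere_area [set: vec3 R] = (4 * pi)%:E.
Proof.
rewrite /sphere_area preimage_setT setIT integral_mkcond.
rewrite fubini_tonelli1/=; last 2 first.
- apply/(measurable_restrictT _ measurable_sphere_chart_domain).
  exact: measurable_sin1.
- by move=> p; rewrite patchE; case: ifPn => // /set_mem; exact: sin_dom_ge0.
transitivity (\int[leb]_(x in `[0%R, pi]) ((2 * pi)%R%:E * (sin x)%:E))%E.
  rewrite [RHS]integral_mkcond; apply: eq_integral => x _.
  rewrite /fubini_F /= patchE; case: ifPn => x0pi.
    transitivity (\int[leb]_(y in `[0%R, (2 * pi)%R]) (sin x)%:E)%E.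
      rewrite [RHS]integral_mkcond; apply: eq_integral => y _.
      by rewrite !patchE /sphere_chart_domain in_setX x0pi.
    rewrite integral_cst//= lebesgue_measure_itv/= lte_fin.
    by rewrite mulr_gt0 ?pi_gt0// -EFinB subr0 muleC.
  apply: integral0_eq => y _.
  by rewrite patchE /sphere_chart_domain in_setX (negbTE x0pi).
rewrite ge0_integralZl//.
- by rewrite integral_sin_0_pi -EFinM; congr EFin; ring.
- by apply: measurable_funTS; apply/measurable_EFinP.
- by move=> x /=; rewrite in_itv/= => x0pi; rewrite lee_fin sin_ge0_pi.
- by rewrite lee_fin mulr_ge0// pi_ge0.
Qed.

Let uniform_sphere0 : uniform_sphere (@set0 (vec3 R)) = 0%E.
Proof. by rewrite /uniform_sphere measure0 mule0. Qed.

Let invr_4pi_ge0 : (0 <= (4 * pi : R)^-1).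
Proof. by rewrite invr_ge0 mulr_ge0// pi_ge0. Qed.

Let uniform_sphere_ge0 (A : set (vec3 R)) : (0 <= uniform_sphere A)%E.
Proof. by rewrite mule_ge0. Qed.

Let uniform_sphere_sigma_additive : semi_sigma_additive (@uniform_sphere R).
Proof. exact: (@measure_semi_sigma_additive _ _ _
  (mscale (NngNum invr_4pi_ge0) (@sphere_area R))). Qed.

HB.instance Definition _ := isMeasure.Build _ _ _ (@uniform_sphere R)
  uniform_sphere0 uniform_sphere_ge0 uniform_sphere_sigma_additive.

Let uniform_sphere_setT : uniform_sphere [set: vec3 R] = 1%E.
Proof.
rewrite /uniform_sphere sphere_area_setT -EFinM mulVf//.
by rewrite mulf_neq0// gt_eqF// pi_gt0.
Qed.

HB.instance Definition _ := Measure_isProbability.Build _ _ _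
  (@uniform_sphere R) uniform_sphere_setT.

Lemma uniform_sphere_unit_sphere : uniform_sphere (@unit_sphere R) = 1%E.
Proof.
rewrite -uniform_sphere_setT /uniform_sphere /sphere_area.
congr (_ * integral _ (_ `&` _) _)%E.
apply/seteqP; split => // -[x y] _; rewrite /= /unit_sphere /dot /=.
rewrite (_ : _ + _ + _ = (sin x) ^+ 2 * (cos y ^+ 2 + sin y ^+ 2) + cos x ^+ 2).
  by rewrite cos2Dsin2 mulr1 addrC cos2Dsin2.
by ring.
Qed.

End uniform_sphere_probability.

(* Three independent uniform points of the sphere, (s_1, s_2, s_3). *)
Definition phase_probability (R : realType) :
    probability (vec3 R * vec3 R * vec3 R)%type R :=
  ((@uniform_sphere R) \x (@uniform_sphere R) \x (@uniform_sphere R))%E.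

Definition hamiltonian {R : realType} (J1 J2 J3 : R)
    (s : vec3 R * vec3 R * vec3 R) : R :=
  let s1 := s.1.1 in let s2 := s.1.2 in let s3 := s.2 in
  J1 * dot s2 s3 + J2 * dot s3 s1 + J3 * dot s1 s2.

Section hamiltonian_measurable.
Context {R : realType} (J1 J2 J3 : R).

Let measurable_dot d (T : measurableType d) (f g : T -> vec3 R) :
  measurable_fun setT f -> measurable_fun setT g ->
  measurable_fun setT (fun x => dot (f x) (g x)).
Proof.
move=> mf mg; rewrite /dot.
by apply: measurable_funD; [apply: measurable_funD|]; apply: measurable_funM;
  repeat (apply: measurableT_comp => //).
Qed.

Let measurable_hamiltonian : measurable_fun setT (hamiltonian J1 J2 J3).
Proof.
rewrite /hamiltonian.
by apply: measurable_funD; [apply: measurable_funD|]; apply: measurable_funM => //;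
  apply: measurable_dot => //; apply: measurableT_comp.
Qed.

HB.instance Definition _ := isMeasurableFun.Build _ _ _ _
  (hamiltonian J1 J2 J3) measurable_hamiltonian.

End hamiltonian_measurable.

Definition is_density {R : realType} (mu : set R -> \bar R) (D : R -> R) : Prop :=
  [/\ measurable_fun [set: R] D,
      forall x, 0 <= D x
    & forall A, measurable A ->
        mu A = (\int[lebesgue_measure]_(x in A) (D x)%:E)%E].

Definition is_density_of_states {R : realType} (J1 J2 J3 : R) (D : R -> R) : Prop :=
  is_density (distribution (phase_probability R) (hamiltonian J1 J2 J3)) D.

(* Main.v *)
Require Import Defs.
From HB Require Import structures.
From mathcomp Require Import all_boot all_order all_algebra.
From mathcomp Require Import ring lra.
From mathcomp Require Import all_classical all_reals all_analysis measurable_realfun.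

Set Implicit Arguments.
Unset Strict Implicit.
Unset Printing Implicit Defensive.

Import Order.TTheory GRing.Theory Num.Theory.
Import numFieldNormedType.Exports.

Local Open Scope classical_set_scope.
Local Open Scope ring_scope.

(** Given s1 and s2, the energy is J3 u + w.s3 with u = s1.s2 and
    w = J1 s2 + J2 s1.  By Archimedes, w.s3 is uniform on [-|w|, |w|], where |w|
    depends on u only, and u is itself uniform on [-1, 1].  Taking r = |w| as
    variable instead of u, the density at e is proportional to the length of
    {r : |e - J3 u(r)| < r}, where J3 u(r) is quadratic in r; for the couplings of
    the theorem this set is an interval whose end points are those of the range
    of r or roots of the two quadratics.

    Archimedes' theorem for an arbitrary direction w is obtained in the fixed
    polar chart: for a fixed colatitude x, w.s is an affine function of the cosine
    of a shifted azimuth, hence follows an arcsine law; integrating over x (where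
    sin x dx is the image measure of dy under y = cos x) leaves, after completing
    the square, the total mass pi of another arcsine law. *)

(** * Change of variables for integrals against densities *)

Section transfer.
Local Open Scope ereal_scope.
Context {R : realType}.

Lemma integral_mkindic d (T : measurableType d)
    (mu : {measure set T -> \bar R}) (A : set T) (f : T -> R) :
  \int[mu]_(x in A) (f x)%:E = \int[mu]_x (\1_A x * f x)%:E.
Proof.
rewrite integral_mkcond; apply: eq_integral => x _.
by rewrite patchE indicE; case: (x \in A); rewrite ?mul1r ?mul0r.
Qed.

Import HBNNSimple.

(** Monotone convergence along simple functions increasing to [g] reduces the integral to masses of
    preimages of level sets, the only data that a change of variables has to match. *)
Let integral_comp_limn d1 d2 (T1 : measurableType d1) (T2 : measurableType d2)
    (mu : {measure set T1 -> \bar R}) (X : T1 -> T2) (f : T1 -> R)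
    (g : T2 -> \bar R) (mg : measurable_fun setT g) :
  measurable_fun setT X -> measurable_fun setT f -> (forall x, 0 <= f x)%R ->
  (forall y, 0 <= g y) ->
  let g_ := nnsfun_approx measurableT mg in
  \int[mu]_x (g (X x) * (f x)%:E) =
  limn (fun n => \sum_(k \in range (g_ n))
    (k%:E * \int[mu]_(x in X @^-1` (g_ n @^-1` [set k])) (f x)%:E)).
Proof.
move=> mX mf f0 g0 g_.
have mXk n k : measurable (X @^-1` (g_ n @^-1` [set k])).
  by rewrite -[X in measurable X]setTI; apply: mX.
transitivity (limn (fun n => \int[mu]_x ((g_ n (X x))%:E * (f x)%:E))).
  rewrite -monotone_convergence//.
  - apply: eq_integral => x _; apply/esym/cvg_lim => //.
    apply: cvgeZr => //.
    by apply: (@cvg_nnsfun_approx _ _ _ _ measurableT _ mg).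
  - move=> n; apply: emeasurable_funM; apply/measurable_EFinP => //.
    exact: (measurableT_comp _ mX).
  - by move=> n x _; rewrite -EFinM lee_fin mulr_ge0.
  - move=> x _ m n mn; rewrite -!EFinM lee_fin ler_wpM2r//.
    exact/lefP/nd_nnsfun_approx.
congr (limn _); apply/funext => n.
transitivity (\int[mu]_x \sum_(k \in range (g_ n))
    (k * (\1_(X @^-1` (g_ n @^-1` [set k])) x * f x))%:E).
  apply: eq_integral => x _; rewrite fimfunE -EFinM.
  rewrite fsbig_finite//= mulr_suml fsbig_finite//= -sumEFin.
  by apply: eq_bigr => k _; rewrite mulrA.
rewrite ge0_integral_fsum//.
- apply: eq_fsbigr => k /set_mem[y _ <-].
  rewrite integral_mkindic -ge0_integralZl//.
  + by apply/measurable_EFinP; apply: measurable_funM.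
  + by move=> x _; rewrite lee_fin mulr_ge0.
  + by rewrite lee_fin.
- move=> k; apply/measurable_EFinP; apply: measurable_funM => //.
  exact: measurable_funM.
- move=> k x _; rewrite lee_fin mulrA mulr_ge0//.
  by have := nnfun_muleindic_ge0 (g_ n) k (X x); rewrite -EFinM lee_fin.
Qed.

(** When [X] sends the measure of density [f] to that of density [h], both sides are the same limit
    from [integral_comp_limn], taken once with [X] and once with the identity. *)
Lemma integral_transfer d1 d2 (T1 : measurableType d1)
    (T2 : measurableType d2) (mu : {measure set T1 -> \bar R})
    (nu : {measure set T2 -> \bar R}) (X : T1 -> T2) (f : T1 -> R)
    (h : T2 -> R) (g : T2 -> \bar R) :
  measurable_fun setT X -> measurable_fun setT f -> measurable_fun setT h ->
  measurable_fun setT g -> (forall x, 0 <= f x)%R -> (forall y, 0 <= h y)%R ->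
  (forall y, 0 <= g y) ->
  (forall A, measurable A ->
    \int[mu]_(x in X @^-1` A) (f x)%:E = \int[nu]_(y in A) (h y)%:E) ->
  \int[mu]_x (g (X x) * (f x)%:E) = \int[nu]_y (g y * (h y)%:E).
Proof.
move=> mX mf mh mg f0 h0 g0 fh.
rewrite (integral_comp_limn mu mg mX mf f0 g0).
rewrite (integral_comp_limn nu mg (@measurable_id _ _ setT) mh h0 g0).
congr (limn _); apply/funext => n; apply: eq_fsbigr => k _.
by rewrite fh.
Qed.

End transfer.

(** * Cosine and arcsine laws *)

Section image_density.
Local Open Scope ereal_scope.
Context {R : realType} d d' (T : measurableType d) (T' : measurableType d').
Variables (mu : {measure set T -> \bar R}) (X : T -> T') (f : T -> R).
Hypotheses (mX : measurable_fun setT X) (mf : measurable_fun setT f).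
Hypothesis f0 : forall x, (0 <= f x)%R.

(* The proofs are arguments so that the measure structure can be inferred. *)
Definition image_density of measurable_fun setT X & measurable_fun setT f
    & (forall x, (0 <= f x)%R) :=
  fun A : set T' => \int[mu]_(x in X @^-1` A) (f x)%:E.

Let image_density0 : image_density mX mf f0 set0 = 0.
Proof. by rewrite /image_density preimage_set0 integral_set0. Qed.

Let image_density_ge0 A : 0 <= image_density mX mf f0 A.
Proof. by apply: integral_ge0 => x _; rewrite lee_fin. Qed.

Let image_density_sigma_additive : semi_sigma_additive (image_density mX mf f0).
Proof.
move=> /= F mF tF mUF; rewrite /image_density; apply: cvg_toP.
  apply: ereal_nondecreasing_is_cvgn => m n mn.
  by apply: lee_sum_nneg_natr => // k _ _; exact: image_density_ge0.
rewrite preimage_bigcup ge0_integral_bigcup//=.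
- by move=> k; rewrite -[Y in measurable Y]setTI; apply: mX.
- by apply: measurable_funTS; exact/measurable_EFinP.
- by move=> x _; rewrite lee_fin.
- apply/trivIsetP => i j _ _ ij; rewrite -preimage_setI.
  by move/trivIsetP : tF => /(_ _ _ _ _ ij) ->//; rewrite preimage_set0.
Qed.

HB.instance Definition _ := isMeasure.Build _ _ _ (image_density mX mf f0)
  image_density0 image_density_ge0 image_density_sigma_additive.

End image_density.

Section cosine_law.
Local Open Scope ereal_scope.
Context {R : realType}.
Local Notation leb := (@lebesgue_measure R).

(** Open rays are stable under intersection and generate the Borel sets; finiteness on the rays
    []-k, +oo[], which exhaust the line, gives uniqueness. *)
Lemma eq_measure_ray (m1 m2 : {measure set (measurableTypeR R) -> \bar R}) :
  (forall x, m1 `]x, +oo[%classic < +oo) ->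
  (forall x, m1 `]x, +oo[%classic = m2 `]x, +oo[%classic) ->
  forall A, measurable A -> m1 A = m2 A.
Proof.
move=> m1oo m12 A mA.
have cover : \bigcup_k `](- k%:R)%R, +oo[%classic = [set: R].
  apply/seteqP; split => // x _.
  exists (Num.bound `|x|%R) => //=; rewrite in_itv/= andbT ltrNl.
  by rewrite (le_lt_trans _ (archi_boundP (normr_ge0 x)))// -normrN ler_norm.
apply: (@g_sigma_algebra_measure_unique _ R (measurableTypeR R)
    (@RGenOInfty.G R) _ (fun k : nat => `](- k%:R)%R, +oo[%classic) _ cover).
- by move=> _ [x ->]; exact: measurable_itv.
- by move=> i; exists (- i%:R)%R.
- move=> _ _ [x ->] [y ->]; exists (Num.max x y).
  by apply/seteqP; split => z; rewrite /= !in_itv/= !andbT gt_max => /andP.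
- by move=> _ [x ->].
- by move=> k.
- by have : (@ocitv R).-sigma.-measurable A by []; rewrite RGenOInfty.measurableE.
Qed.

Lemma integral_sin m b : (0 < b)%R ->
  \int[leb]_(x in `]0%R, b[) (m * sin x)%:E = (m * (1 - cos b))%:E.
Proof.
move=> b0.
have csin : continuous (fun x : R => m * sin x)%R.
  by move=> x; apply: cvgM; [exact: cvg_cst|exact: continuous_sin].
have dcos (x : R) : is_derive x 1%R (fun x => - m * cos x)%R (m * sin x)%R.
  have -> : (fun x : R => - m * cos x)%R = (- m) *: (@cos R) by [].
  by apply: is_derive_eq; rewrite /GRing.scale/= mulrN mulNr opprK.
have ccos (x : R) : {for x, continuous (fun x => - m * cos x)%R}.
  by apply/differentiable_continuous/derivable1_diffP; case: (dcos x).
rewrite -(@integral_itv_bndoo _ _ _ _ true false); last first.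
  apply/measurable_EFinP; apply: measurable_funTS.
  exact: continuous_measurable_fun.
rewrite (@continuous_FTC2 _ _ (fun x => - m * cos x)%R)//.
- by rewrite cos0 -EFinB; congr EFin; ring.
- exact: continuous_subspaceT.
- split; [by move=> x _; case: (dcos x)|exact/cvg_at_right_filter/ccos|].
  exact/cvg_at_left_filter/ccos.
- by move=> x _; rewrite derive1E; case: (dcos x).
Qed.

Let cosD (p m : R) := (fun x : R => p + m * cos x)%R.

Lemma measurable_cos_affine (p m : R) :
  measurable_fun setT (fun x : R => p + m * cos x)%R.
Proof.
apply: measurable_funD => //; apply: measurable_funM => //.
exact: (continuous_measurable_fun (@continuous_cos R)).
Qed.

(** For [m > 0] this is, on []0, pi[], the absolute derivative of [p + m * cos x]; for [m = 1] it is
    also the colatitude factor of the surface element. *)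
Definition sin_density (m x : R) : R := (\1_`]0%R, pi[%classic x * (m * sin x))%R.

Lemma measurable_sin_density m : measurable_fun setT (sin_density m).
Proof.
apply: measurable_funM => //; apply: measurable_funM => //.
exact: (continuous_measurable_fun (@continuous_sin R)).
Qed.

Lemma sin_density_ge0 m x : (0 <= m)%R -> (0 <= sin_density m x)%R.
Proof.
move=> m0; rewrite /sin_density indicE.
have [|] := boolP (x \in `]0%R, pi[%classic); rewrite ?mul0r ?mul1r//.
rewrite inE/= in_itv/= => /andP[x0 xpi].
by rewrite mulr_ge0// sin_ge0_pi// !ltW.
Qed.

Lemma integral_sin_density m b : (0 < b <= pi)%R ->
  \int[leb]_(x in `]0%R, b[) (sin_density m x)%:E = (m * (1 - cos b))%:E.
Proof.
move=> /andP[b0 bpi]; rewrite -integral_sin//; apply: eq_integral => x.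
rewrite inE/= in_itv/= /sin_density indicE => /andP[x0 xb].
by rewrite mem_set ?mul1r//= in_itv/= x0 (lt_le_trans xb).
Qed.

(** On []0, pi[] the map decreases from [p + m] to [p - m], so the points sent into a ray form an
    initial interval []0, b[], of mass [m * (1 - cos b)], or the empty set. *)
Let cos_affine_ray (p m x : R) : (0 < m)%R ->
  \int[leb]_(y in cosD p m @^-1` `]x, +oo[) (sin_density m y)%:E =
  leb (`](p - m)%R, (p + m)%R[ `&` `]x, +oo[).
Proof.
move=> m0.
have restr : \int[leb]_(y in cosD p m @^-1` `]x, +oo[) (sin_density m y)%:E =
    \int[leb]_(y in [set y | (0 < y < pi) && (x < cosD p m y)]%R)
      (sin_density m y)%:E.
  rewrite [LHS]integral_mkindic [RHS]integral_mkindic.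
  apply: eq_integral => y _; congr EFin; rewrite /sin_density !indicE.
  have -> : (y \in cosD p m @^-1` `]x, +oo[%classic) = (x < cosD p m y)%R.
    by apply/idP/idP; rewrite inE/= in_itv/= andbT.
  have -> : (y \in `]0%R, pi[%classic) = (0 < y < pi)%R.
    by apply/idP/idP; rewrite inE/= in_itv.
  have -> : (y \in [set y | (0 < y < pi)%R && (x < cosD p m y)%R]) =
      ((0 < y < pi)%R && (x < cosD p m y)%R).
    by apply/idP/idP; rewrite inE.
  by case: (0 < y < pi)%R; case: (x < _)%R; rewrite /= !(mul0r, mulr0, mul1r).
rewrite restr.
have [xm|xm] := leP x (p - m)%R.
  rewrite (_ : [set y | _] = `]0%R, pi[%classic); last first.
    apply/seteqP; split => y /=; rewrite in_itv/=; first by case/andP.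
    move=> yp; rewrite yp/= /cosD (le_lt_trans xm)// ltrD2l -subr_gt0 opprK.
    rewrite -[X in (_ + X)%R]mulr1 -mulrDr mulr_gt0//.
    rewrite -ltrBlDr sub0r -cospi.
    by case/andP: yp => y0 ypi; rewrite ltr_cos// in_itv/= ?lexx ?pi_ge0// !ltW.
  rewrite integral_sin_density ?pi_gt0/=// (_ : _ `&` _ = `]p - m, p + m[%classic)%R.
    rewrite lebesgue_measure_itv/= lte_fin cospi.
    rewrite ifT -?EFinB; last by lra.
    by congr EFin; ring.
  apply/setIidPl => y /=; rewrite !in_itv/= andbT => /andP[+ _].
  exact: le_lt_trans.
have [xM|xM] := leP (p + m)%R x.
  rewrite (_ : [set y | _] = set0) ?integral_set0; last first.
    apply/seteqP; split => y //= /andP[_]; rewrite /cosD ltNge => /negP; apply.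
    by rewrite (le_trans _ xM)// lerD2l ger_pMr// cos_le1.
  rewrite (_ : _ `&` _ = set0) ?measure0//.
  apply/seteqP; split => y //=; rewrite !in_itv/= andbT => -[/andP[_ yM] xy].
  by have := lt_trans yM (le_lt_trans xM xy); rewrite ltxx.
(* The remaining case: the ray starts inside the range, at the value taken at [acos c]. *)
pose c := ((x - p) / m)%R.
have cB : (-1 < c < 1)%R.
  rewrite ltr_pdivlMr// ltr_pdivrMr//; lra.
have xE : (x = p + m * c)%R by rewrite /c mulrC divfK ?gt_eqF//; ring.
have acB : (0 < acos c < pi)%R.
  by case/andP: cB => c1 c2; rewrite acos_gt0 ?acos_ltpi ?c1 ?c2 ?ltW.
have acK : cos (acos c) = c.
  by rewrite acosK// in_itv/=; case/andP: cB => c1 c2; rewrite !ltW.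
rewrite (_ : [set y | _] = `]0%R, acos c[%classic); last first.
  apply/seteqP; split => y /=; rewrite in_itv/= xE /cosD ltrD2l ltr_pM2l//.
    move=> /andP[/andP[y0 ypi]]; rewrite y0/= -{1}acK.
    by rewrite ltr_cos// in_itv/= ?(ltW y0) ?(ltW ypi)//; case/andP: acB => ? ?; rewrite !ltW.
  case/andP: acB => a0 api /andP[y0 ya]; have ypi := lt_trans ya api.
  by rewrite y0 ypi/= -{1}acK ltr_cos// in_itv/= ?ltW.
rewrite integral_sin_density; last by case/andP: acB => -> /ltW.
rewrite (_ : _ `&` _ = `]x, p + m[%classic)%R; last first.
  apply/seteqP; split => y /=; rewrite !in_itv/= andbT.
    by move=> [/andP[_ ->] ->].
  by move=> /andP[xy yM]; rewrite xy yM (lt_trans xm xy).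
rewrite lebesgue_measure_itv/= lte_fin xM acK -EFinB; congr EFin.
by rewrite [in RHS]xE; ring.
Qed.

Lemma cos_affine_law (p m : R) A : (0 < m)%R -> measurable A ->
  \int[leb]_(x in (fun x : R => p + m * cos x)%R @^-1` A) (sin_density m x)%:E =
  leb (`](p - m)%R, (p + m)%R[ `&` A).
Proof.
move=> m0 mA.
have as0 x : (0 <= sin_density m x)%R by exact/sin_density_ge0/ltW.
have mI : measurable (`]p - m, p + m[%classic : set R)%R by exact: measurable_itv.
(* Both sides are recast as measures of [A], a restriction and an image, so that agreement on rays
   suffices. *)
rewrite setIC -[RHS]/(mrestr leb mI A).
rewrite -[LHS]/(image_density leb
  (measurable_cos_affine p m : measurable_fun setT (_ : R -> measurableTypeR R))
  (measurable_sin_density m) as0 A).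
apply: eq_measure_ray => // x; rewrite /image_density /=.
  rewrite [ltLHS]cos_affine_ray// (@le_lt_trans _ _ (leb `](p - m)%R, (p + m)%R[))//.
    by apply: le_measure; rewrite ?inE//; exact: measurableI.
  by rewrite lebesgue_measure_itv/=; case: ifPn => _; rewrite ltry.
by rewrite [LHS]cos_affine_ray// /mrestr setIC.
Qed.

End cosine_law.

Section arcsine_law.
Local Open Scope ereal_scope.
Context {R : realType}.
Local Notation leb := (@lebesgue_measure R).

Lemma integral_cos_affine (p m : R) (g : R -> \bar R) : (0 < m)%R ->
  measurable_fun setT g -> (forall t, 0 <= g t) ->
  \int[leb]_x (g (p + m * cos x)%R * (sin_density m x)%:E) =
  \int[leb]_t (g t * (\1_(`](p - m)%R, (p + m)%R[%classic : set R) t)%:E).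
Proof.
move=> m0 mg g0.
apply: (@integral_transfer R _ _ _ _ leb leb
  (fun x => p + m * cos x)%R (sin_density m) (\1_`](p - m)%R, (p + m)%R[%classic) g) => //.
- exact: measurable_cos_affine.
- exact: measurable_sin_density.
- by move=> x; exact/sin_density_ge0/ltW.
- by move=> A mA; rewrite cos_affine_law// integral_indic.
Qed.

(* It vanishes when M <= (t - p)^2, as the square root of a nonpositive number
   and the inverse of 0 are both 0. *)
Definition arcsine_pdf (p M t : R) : R := (Num.sqrt (M - (t - p) ^+ 2))^-1%R.

Lemma measurable_invr_sqrt :
  measurable_fun setT (fun x : R => (Num.sqrt x)^-1)%R.
Proof.
(* As a real power the inverse is measurable on the whole line, in spite of its discontinuity at
   0. *)
rewrite (_ : (fun x => _) = fun x : R => Num.sqrt x `^ (-1))%R; last first.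
  by apply/funext => x; rewrite powR_inv1// sqrtr_ge0.
apply: (measurableT_comp (measurable_powR _)).
exact: (continuous_measurable_fun (@sqrt_continuous R)).
Qed.

Lemma measurable_fun_arcsine_pdf d (T : measurableType d) (p M t : T -> R) :
  measurable_fun setT p -> measurable_fun setT M -> measurable_fun setT t ->
  measurable_fun setT (fun x => arcsine_pdf (p x) (M x) (t x)).
Proof.
move=> mp mM mt; apply: (measurableT_comp measurable_invr_sqrt).
by apply: measurable_funB => //; apply: measurable_funX; exact: measurable_funB.
Qed.

Lemma arcsine_pdf_ge0 (p M t : R) : (0 <= arcsine_pdf p M t)%R.
Proof. by rewrite invr_ge0 sqrtr_ge0. Qed.

Lemma arcsine_pdf_out (p M t : R) : (M <= (t - p) ^+ 2)%R -> arcsine_pdf p M t = 0%R.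
Proof. by move=> h; rewrite /arcsine_pdf ler0_sqrtr ?invr0// subr_le0. Qed.

(** At [t = p + m * cos x] the radicand is [(m * sin x) ^+ 2], so the pdf is the inverse of
    [sin_density m], and [integral_cos_affine] leaves only the indicator of the preimage. *)
Lemma arcsine_law (p m : R) (A : set R) : (0 < m)%R -> measurable A ->
  leb (`]0%R, pi[ `&` (fun x => p + m * cos x)%R @^-1` A) =
  \int[leb]_(t in A) (arcsine_pdf p (m ^+ 2) t)%:E.
Proof.
move=> m0 mA; rewrite integral_mkindic.
have mg : measurable_fun setT
    (fun t => (\1_A t * arcsine_pdf p (m ^+ 2) t)%:E).
  apply/measurable_EFinP; apply: measurable_funM => //.
  exact: measurable_fun_arcsine_pdf.
have g0 t : 0 <= (\1_A t * arcsine_pdf p (m ^+ 2) t)%:E.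
  by rewrite lee_fin mulr_ge0// arcsine_pdf_ge0.
have := integral_cos_affine p m0 mg g0 => /= H.
transitivity (\int[leb]_t ((\1_A t * arcsine_pdf p (m ^+ 2) t)%:E *
    (\1_(`](p - m)%R, (p + m)%R[%classic : set R) t)%:E)); last first.
  apply: eq_integral => t _; rewrite -EFinM; congr EFin.
  rewrite indicE [in X in (_ * X)%R]indicE.
  have [tI|tI] := boolP (t \in `](p - m)%R, (p + m)%R[%classic); first by rewrite mulr1.
  (* Outside the interval the pdf already has its default value 0, so the indicator changes
     nothing. *)
  rewrite mulr0 arcsine_pdf_out ?mulr0//.
  move: tI; rewrite notin_setE/= in_itv/= => /negP; rewrite negb_and -!leNgt => tI.
  have : (m <= `|t - p|)%R by rewrite ler_normr; case/orP: tI => h; apply/orP; [right|left]; lra.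
  move=> mt; rewrite -[leRHS]real_normK ?num_real//.
  by rewrite ler_pXn2r// nnegrE ltW.
rewrite -H -integral_indic//.
- rewrite integral_mkindic; apply: eq_integral => x _.
  rewrite -EFinM; congr EFin; rewrite /sin_density !indicE.
  have -> : (x \in (fun x => p + m * cos x)%R @^-1` A) = ((p + m * cos x)%R \in A).
    by apply/idP/idP; rewrite !inE.
  have [x0pi|] := boolP (x \in `]0%R, pi[%classic); last by rewrite !(mulr0, mul0r).
  have s0 : (0 < sin x)%R.
    by apply: sin_gt0_pi; move: x0pi; rewrite inE/= in_itv.
  rewrite mul1r !mulr1 /arcsine_pdf.
  have -> : (m ^+ 2 - (p + m * cos x - p) ^+ 2 = (m * sin x) ^+ 2)%R.
    by rewrite addrAC subrr add0r !exprMn sin2cos2 mulrBr mulr1.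
  rewrite sqrtr_sqr ger0_norm ?mulr_ge0 ?ltW// -mulrA mulVf ?mulr1//.
  by rewrite mulf_neq0// gt_eqF.
- by rewrite -[X in measurable X]setTI; exact: measurable_cos_affine.
Qed.

(** For [0 < M] this is the arcsine law on the whole line, that is the length of []0, pi[];
    otherwise the pdf vanishes identically. *)
Lemma integral_arcsine_pdf (p M : R) :
  \int[leb]_t (arcsine_pdf p M t)%:E = if (0 < M)%R then pi%:E else 0.
Proof.
have [M0|M0] := ltP 0%R M.
  rewrite -{1}(sqr_sqrtr (ltW M0)) -arcsine_law ?sqrtr_gt0//.
  by rewrite preimage_setT setIT lebesgue_measure_itv/= lte_fin pi_gt0 -EFinB subr0.
apply: integral0_eq => t _; rewrite arcsine_pdf_out//.
by rewrite (le_trans M0)// sqr_ge0.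
Qed.

End arcsine_law.

(** * Removing the phase of a shifted azimuth *)

Section azimuth.
Local Open Scope ereal_scope.
Context {R : realType}.
Local Notation leb := (@lebesgue_measure R).

(** The translated measure gives []a, b]] its length, which characterizes Lebesgue measure. *)
Lemma lebesgue_measure_shift (c : R) (A : set R) : measurable A ->
  leb ((fun x => x + c)%R @^-1` A) = leb A.
Proof.
move=> mA.
have mD : measurable_fun setT (fun x : R => x + c : measurableTypeR R)%R.
  exact: measurable_funD.
rewrite -[LHS]/(pushforward leb (fun x : R => x + c : measurableTypeR R)%R A).
apply/esym/lebesgue_measure_unique => //= _ [[a b]] _ <-.
rewrite /pushforward (_ : _ @^-1` _ = `](a - c)%R, (b - c)%R]%classic).
  by rewrite !lebesgue_measure_itv/= !lte_fin ltrD2r -!EFinB opprB addrA subrK.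
by apply/seteqP; split => x /=; rewrite !in_itv/= ltrBlDr lerBrDr.
Qed.

Lemma lebesgue_measure_itv_setI (a b : R) b0 b1 (A : set R) : measurable A ->
  leb ([set` Interval (BSide b0 a) (BSide b1 b)] `&` A) = leb (`]a, b[ `&` A).
Proof.
move=> mA.
rewrite setIC -integral_indic// integral_itv_bndoo.
  by rewrite integral_indic// setIC.
by apply/measurable_EFinP; exact: measurable_indic.
Qed.

Lemma lebesgue_measure_itv_split (a c b : R) (A : set R) : measurable A ->
  (a <= c <= b)%R ->
  leb (`]a, b] `&` A) = leb (`]a, c] `&` A) + leb (`]c, b] `&` A).
Proof.
move=> mA /andP[ac cb]; rewrite -measureU.
- by rewrite -setIUl -itv_bndbnd_setU.
- exact: measurableI.
- exact: measurableI.
- rewrite setIACA -subset0 => x /= -[[]]; rewrite !in_itv/=.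
  by move=> /andP[_ xc] /andP[cx _]; rewrite ltNge xc in cx.
Qed.

Lemma cosB2pi (x : R) : cos (x - 2 * pi) = cos x.
Proof.
transitivity (cos (x - 2 * pi + pi + pi)); first by rewrite !cosDpi opprK.
by congr cos; ring.
Qed.

(** Cut []0, 2 pi]] at [psi], translate the pieces by [2 pi - psi] and [- psi], and periodicity
    reassembles a full period without phase. Its two halves are mirror images, hence the factor
    2. *)
Lemma cos_shift_law (psi : R) (B : set R) : (0 <= psi <= 2 * pi)%R ->
  measurable B ->
  leb (`[0%R, (2 * pi)%R] `&` (fun x => cos (x - psi)%R) @^-1` B) =
  2%:E * leb (`]0%R, pi[ `&` cos @^-1` B).
Proof.
move=> /andP[psi0 psi2] mB.
have mC : measurable (cos @^-1` B : set R).
  rewrite -[X in measurable X]setTI.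
  exact: (continuous_measurable_fun (@continuous_cos R)).
have mS : measurable ((fun x => cos (x - psi)%R) @^-1` B : set R).
  rewrite -[X in measurable X]setTI.
  apply: (measurableT_comp (continuous_measurable_fun (@continuous_cos R))) => //.
  exact: measurable_funB.
set C := cos @^-1` B in mC *; set S := _ @^-1` B.
rewrite lebesgue_measure_itv_setI// -(lebesgue_measure_itv_setI _ _ false false)//.
rewrite (lebesgue_measure_itv_split mS (c := psi)) ?psi0//.
rewrite -(@lebesgue_measure_shift (psi - 2 * pi) (`]0%R, psi] `&` S)); last exact: measurableI.
rewrite -(@lebesgue_measure_shift psi (`]psi, (2 * pi)%R] `&` S)); last exact: measurableI.
have -> : (fun x => x + (psi - 2 * pi))%R @^-1` (`]0%R, psi] `&` S) =
    `](2 * pi - psi)%R, (2 * pi)%R] `&` C.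
  apply/seteqP; split => x /=; rewrite !in_itv/= => -[/andP[x1 x2]];
    rewrite /S /C/= (_ : _ - psi = x - 2 * pi)%R; [|ring| |ring];
    by rewrite cosB2pi => h; split => //; apply/andP; split; lra.
have -> : (fun x => x + psi)%R @^-1` (`]psi, (2 * pi)%R] `&` S) =
    `]0%R, (2 * pi - psi)%R] `&` C.
  apply/seteqP; split => x /=; rewrite !in_itv/= => -[/andP[x1 x2]]; rewrite /S /C/= addrK => h.
    by split => //; apply/andP; split; lra.
  by split => //; apply/andP; split; lra.
rewrite addeC -lebesgue_measure_itv_split//; last by apply/andP; split; lra.
have pi0 := pi_ge0 R.
rewrite (lebesgue_measure_itv_split mC (c := pi)); last by apply/andP; split; lra.
rewrite lebesgue_measure_itv_setI// mule_natl mule2n.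
congr (_ + _).
(* Translation and sign change compose to [x |-> 2 pi - x], which carries the second half of the
   period onto the first and preserves the cosine. *)
rewrite -(@lebesgue_measure_shift (2 * pi)); last exact: measurableI.
rewrite -lebesgue_measureN; last first.
  rewrite -[X in measurable X]setTI; apply: measurable_funD => //.
  exact: measurableI.
rewrite /pushforward -[RHS](lebesgue_measure_itv_setI _ _ true true)//.
have cE (x : R) : cos (- x + 2 * pi) = cos x.
  by rewrite -[RHS]cosB2pi -[RHS]cosN opprB addrC.
congr (leb _); apply/seteqP; split => x /=; rewrite !in_itv/= => -[/andP[x1 x2]];
  by rewrite /C/= cE => h; split=> //; apply/andP; split; lra.
Qed.

End azimuth.

(** * Linear forms on the sphere *)

Section linear_law.
Local Open Scope ereal_scope.
Context {R : realType}.
Local Notation leb := (@lebesgue_measure R).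

Lemma polar_coordinates (a b : R) : exists rho psi : R,
  [/\ (0 <= rho)%R, (0 <= psi <= 2 * pi)%R, a = (rho * cos psi)%R &
      b = (rho * sin psi)%R].
Proof.
pose rho := Num.sqrt (a ^+ 2 + b ^+ 2).
have rho2 : (rho ^+ 2 = a ^+ 2 + b ^+ 2)%R by rewrite sqr_sqrtr// addr_ge0 ?sqr_ge0.
have [rho0|rho0] := eqVneq rho 0%R.
  exists 0%R, 0%R; rewrite !mul0r lexx/= mulr_ge0 ?pi_ge0//.
  move/eqP: rho2; rewrite rho0 expr0n/= eq_sym paddr_eq0 ?sqr_ge0// !sqrf_eq0.
  by move=> /andP[/eqP -> /eqP ->].
have rhop : (0 < rho)%R by rewrite lt_neqAle eq_sym rho0 sqrtr_ge0.
pose x := (a / rho)%R; pose y := (b / rho)%R.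
have xy : (x ^+ 2 + y ^+ 2 = 1)%R.
  by rewrite !expr_div_n -mulrDl -rho2 divff// expf_neq0.
have xB : (-1 <= x <= 1)%R.
  by rewrite -ler_norml -(@expr_le1 _ 2)// real_normK ?num_real// -xy lerDl sqr_ge0.
have yE : (Num.sqrt (1 - x ^+ 2) = `|y|)%R by rewrite -xy addrAC subrr add0r sqrtr_sqr.
have aE : (a = rho * x)%R by rewrite mulrC divfK.
have bE : (b = rho * y)%R by rewrite mulrC divfK.
have xi : x \in `[(-1)%R, 1%R] by rewrite in_itv.
have a0 := acos_ge0 xB; have api := acos_lepi xB; have pi0 := pi_ge0 R.
(* The arc cosine only gives angles in [[0, pi]]; for negative [y] the angle is [2 pi - acos x]. *)
have [y0|y0] := leP 0%R y.
- exists rho, (acos x); split; first exact: ltW.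
  + by apply/andP; split; lra.
  + by rewrite acosK.
  + by rewrite sin_acos// yE ger0_norm.
- exists rho, (- (acos x - 2 * pi))%R; split; first exact: ltW.
  + by apply/andP; split; lra.
  + by rewrite cosN cosB2pi acosK.
  + rewrite sinN (_ : acos x - 2 * pi = acos x - pi - pi)%R; last by ring.
    rewrite -[sin _]opprK -sinDpi subrK -[sin _]opprK -sinDpi subrK opprK.
    by rewrite sin_acos// yE ltr0_norm// opprK.
Qed.

(** Tonelli in the polar chart: at each colatitude [x] the azimuthal section of [B] is measured,
    with weight [sin x]. *)
Lemma uniform_sphereE (B : set (vec3 R)) : measurable B ->
  uniform_sphere B = ((4 * pi)^-1)%:E * \int[leb]_x ((sin_density 1 x)%:E *
    leb (`[0%R, (2 * pi)%R] `&` (fun y => sphere_chart (x, y)) @^-1` B)).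
Proof.
move=> mB; rewrite /uniform_sphere /sphere_area; congr (_ * _).
set D := _ `&` _.
have mD : measurable D.
  apply: measurableI; first exact: measurable_sphere_chart_domain.
  by rewrite -[X in measurable X]setTI; exact: measurable_sphere_chart.
have msection (x : R) : measurable ((`[0%R, (2 * pi)%R] `&`
    (fun y => sphere_chart (x, y)) @^-1` B) : set R).
  apply: measurableI => //; rewrite -[X in measurable X]setTI.
  by apply: (measurableT_comp measurable_sphere_chart).
have msin : measurable_fun setT (fun p : R * R => (\1_D p * sin p.1)%R).
  apply: measurable_funM => //.
  exact: (measurableT_comp (continuous_measurable_fun (@continuous_sin R))).
rewrite (integral_mkindic (leb \x leb)%E D (fun p => sin p.1)) fubini_tonelli1/=; last 2 first.
- exact/measurable_EFinP.
- move=> p; rewrite lee_fin indicE; have [|] := boolP (p \in D); rewrite ?mul0r ?mul1r//.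
  by move=> /set_mem[[/= + _] _]; rewrite in_itv/= => /sin_ge0_pi.
apply: eq_integral => x _; rewrite /fubini_F.
transitivity (\int[leb]_y ((sin_density 1 x)%:E * (\1_(`[0%R, (2 * pi)%R] `&`
    (fun y => sphere_chart (x, y)) @^-1` B) y)%:E)).
  apply: eq_integral => y _; rewrite -EFinM; congr EFin.
  rewrite /sin_density !indicE mul1r.
  have -> : ((x, y) \in D) = (0 <= x <= pi)%R &&
      (y \in `[0%R, (2 * pi)%R] `&` (fun y => sphere_chart (x, y)) @^-1` B).
    apply/idP/idP.
      by move=> /set_mem[[/= + yI] By]; rewrite in_itv/= => ->; rewrite /= mem_set.
    by move=> /andP[x0 /set_mem[yI By]]; apply/mem_set; split.
  have -> : (x \in `]0%R, pi[%classic) = (0 < x < pi)%R.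
    by apply/idP/idP; rewrite inE/= in_itv.
  rewrite [RHS]mulrC mulrA -natrM mulnb [in RHS]andbC.
  (* The closed chart and the open interval of [sin_density] differ only at the poles, where the
     sine is 0. *)
  have [->|x0] := eqVneq x 0%R; first by rewrite sin0 !mulr0.
  have [->|xpi] := eqVneq x pi; first by rewrite sinpi !mulr0.
  by rewrite !lt_neqAle eq_sym x0 xpi.
rewrite ge0_integralZl//.
- rewrite integral_indic ?setIT//; exact: msection.
- by apply/measurable_EFinP; apply: measurable_indic; exact: msection.
- by rewrite lee_fin sin_density_ge0.
Qed.

Lemma measurable_dotl (w : vec3 R) : measurable_fun setT (dot w).
Proof.
by apply: measurable_funD; [apply: measurable_funD|]; apply: measurable_funM => //;
  repeat (apply: measurableT_comp => //).
Qed.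

(** At colatitude [x] the linear form is [c * cos x + rho * sin x * cos (y - psi)], and
    [cos_shift_law] removes [psi]. *)
Let inner_law (rho psi c q x : R) (A : set R) : measurable A ->
  (0 <= psi <= 2 * pi)%R ->
  leb (`[0%R, (2 * pi)%R] `&` (fun y => sphere_chart (x, y)) @^-1`
    ((fun s => q + dot (rho * cos psi, rho * sin psi, c) s)%R @^-1` A)) =
  2%:E * leb (`]0%R, pi[ `&`
    (fun y => (q + c * cos x) + (rho * sin x) * cos y)%R @^-1` A).
Proof.
move=> mA psiI.
pose B := (fun z => (q + c * cos x) + (rho * sin x) * z)%R @^-1` A.
have mB : measurable B.
  rewrite -[X in measurable X]setTI.
  have : measurable_fun setT (fun z : R => (q + c * cos x) + (rho * sin x) * z)%R.
    by apply: measurable_funD => //; exact: measurable_funM.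
  exact.
rewrite -(cos_shift_law psiI mB); congr (leb (_ `&` _)).
apply/funext => y; rewrite /preimage /B/= /dot/= cosB.
by congr (A _); ring.
Qed.

Lemma uniform_sphere_linear_neq0 (rho psi c q r : R) (A : set R) : measurable A ->
  (0 <= psi <= 2 * pi)%R -> (0 < rho)%R -> (0 < r)%R ->
  (rho ^+ 2 + c ^+ 2 = r ^+ 2)%R ->
  uniform_sphere ((fun s => q + dot (rho * cos psi, rho * sin psi, c) s)%R @^-1` A) =
  ((2 * r)^-1)%:E * leb (`](q - r)%R, (q + r)%R[ `&` A).
Proof.
move=> mA psiI rho0 r0 rhoc.
rewrite uniform_sphereE; last first.
  rewrite -[X in measurable X]setTI.
  by apply: measurable_funD => //; exact: measurable_dotl.
(* The squared amplitude [(rho * sin x) ^+ 2] is written with [cos x] alone, in view of the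
   substitution [y = cos x]. *)
pose pdf (x t : R) := arcsine_pdf (q + c * cos x) (rho ^+ 2 * (1 - cos x ^+ 2)) t.
pose G (z : R * R) := (sin_density 1 z.1 * (\1_A z.2 * pdf z.1 z.2))%:E.
have mG : measurable_fun setT G.
  have mc : measurable_fun setT (fun z : R * R => cos z.1).
    exact: (measurableT_comp (continuous_measurable_fun (@continuous_cos R))).
  apply/measurable_EFinP; apply: measurable_funM.
    exact: (measurableT_comp (measurable_sin_density 1)).
  have mI : measurable_fun setT (\1_A : R -> R) by exact: measurable_indic.
  apply: measurable_funM; first exact: (measurableT_comp mI measurable_snd).
  apply: measurable_fun_arcsine_pdf => //.
    by apply: measurable_funD => //; exact: measurable_funM.
  apply: measurable_funM => //; apply: measurable_funB => //.
  exact: measurable_funX.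
have G0 z : 0 <= G z.
  by rewrite lee_fin mulr_ge0 ?sin_density_ge0// mulr_ge0// arcsine_pdf_ge0.
transitivity (((4 * pi)^-1)%:E * (2%:E *
  \int[leb]_x \int[leb]_t (sin_density 1 x * (\1_A t * pdf x t))%:E)).
  have mpdf x : measurable_fun setT (pdf x) by exact: measurable_fun_arcsine_pdf.
  have mApdf x : measurable_fun setT (fun t => \1_A t * pdf x t)%R.
    exact: measurable_funM.
  congr (_ * _); rewrite -ge0_integralZl//; last 2 first.
  - exact: (@measurable_fun_fubini_tonelli_F _ _ _ _ _ leb G mG G0).
  - by move=> x _; apply: integral_ge0 => t _; exact: (G0 (x, t)).
  apply: eq_integral => x _.
  under eq_integral do rewrite EFinM.
  rewrite ge0_integralZl//; last 3 first.
  - by apply/measurable_EFinP; exact: mApdf.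
  - by move=> t _; rewrite lee_fin mulr_ge0// arcsine_pdf_ge0.
  - by rewrite lee_fin sin_density_ge0.
  rewrite inner_law// muleCA.
  have [x0|] := boolP (x \in `]0%R, pi[%classic); last first.
    by move=> x0; rewrite /sin_density indicE (negbTE x0) !mul0r !mul0e !mule0.
  have s0 : (0 < sin x)%R.
    by apply: sin_gt0_pi; move: x0; rewrite inE/= in_itv.
  rewrite arcsine_law ?mulr_gt0// integral_mkindic.
  congr (_ * (_ * _)); apply: eq_integral => t _.
  by rewrite /pdf exprMn sin2cos2.
have -> : \int[leb]_x \int[leb]_t (sin_density 1 x * (\1_A t * pdf x t))%:E =
    \int[leb]_t \int[leb]_x (sin_density 1 x * (\1_A t * pdf x t))%:E.
  exact: (@fubini_tonelli _ _ _ _ _ leb leb G mG G0).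
(* After exchanging the integrals, the colatitude integral at a fixed [t] should be [pi / r] inside
   the interval and 0 outside. *)
transitivity (((4 * pi)^-1)%:E * (2%:E * \int[leb]_t
    ((pi / r)%:E * (\1_(`](q - r)%R, (q + r)%R[ `&` A) t)%:E))); last first.
  rewrite ge0_integralZl//; last 2 first.
  - by apply/measurable_EFinP; apply: measurable_indic; exact: measurableI.
  - by rewrite lee_fin divr_ge0 ?pi_ge0 ?ltW.
  rewrite integral_indic ?setIT//; last exact: measurableI.
  rewrite !muleA -!EFinM; congr (_%:E * _).
  have rn0 : r != 0%R by rewrite gt_eqF.
  have pn0 : (pi : R) != 0%R by rewrite gt_eqF// pi_gt0.
  by move: pi pn0 => P pn0; field; rewrite rn0 pn0.
congr (_ * (_ * _)); apply: eq_integral => t _.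
pose k (y : R) := (\1_A t * arcsine_pdf (q + c * y) (rho ^+ 2 * (1 - y ^+ 2)) t)%:E.
transitivity (\int[leb]_x (k (0 + 1 * cos x)%R * (sin_density 1 x)%:E)).
  by apply: eq_integral => x _; rewrite /k -EFinM add0r mul1r mulrC.
rewrite integral_cos_affine//; last 2 first.
- apply/measurable_EFinP; apply: measurable_funM => //.
  apply: measurable_fun_arcsine_pdf => //.
    by apply: measurable_funD => //; exact: measurable_funM.
  by apply: measurable_funM => //; exact: measurable_funB.
- by move=> y; rewrite lee_fin mulr_ge0 ?arcsine_pdf_ge0.
(* With tau = t - q, completing the square in y gives
   rho^2 (1 - y^2) - (tau - c y)^2
     = r^2 (rho^2 (r^2 - tau^2) / r^4 - (y - c tau / r^2)^2). *)
pose p' := (c * (t - q) / r ^+ 2)%R.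
pose M' := (rho ^+ 2 * (r ^+ 2 - (t - q) ^+ 2) / r ^+ 4)%R.
have square y : (rho ^+ 2 * (1 - y ^+ 2) - (t - (q + c * y)) ^+ 2 =
    r ^+ 2 * (M' - (y - p') ^+ 2))%R.
  have -> : (rho ^+ 2 = r ^+ 2 - c ^+ 2)%R by rewrite -rhoc addrK.
  rewrite /M' /p'.
  have -> : (rho ^+ 2 = r ^+ 2 - c ^+ 2)%R by rewrite -rhoc addrK.
  by field; rewrite gt_eqF.
transitivity (\int[leb]_y ((\1_A t / r)%:E * (arcsine_pdf p' M' y)%:E)).
  apply: eq_integral => y _; rewrite /k -!EFinM; congr EFin.
  have -> : arcsine_pdf (q + c * y) (rho ^+ 2 * (1 - y ^+ 2)) t =
      (r^-1 * arcsine_pdf p' M' y)%R.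
    rewrite /arcsine_pdf square sqrtrM ?sqr_ge0// sqrtr_sqr gtr0_norm//.
    by rewrite invfM.
  rewrite (mulrA (\1_A t)) [X in (_ * X = _)%R]indicE.
  have [|yI] := boolP (y \in `](0 - 1)%R, (0 + 1)%R[%classic); first by rewrite mulr1.
  (* For [y] outside []-1, 1[] the radicand is nonpositive, so the integral over []-1, 1[] extends
     to the whole line. *)
  rewrite mulr0 arcsine_pdf_out ?mulr0// -subr_le0 -(pmulr_rle0 _ (exprn_gt0 2 r0)) -square.
  move: yI; rewrite notin_setE/= in_itv/= => /negP; rewrite negb_and -!leNgt => yI.
  have y1 : (1 - y ^+ 2 <= 0)%R by case/orP: yI => yI; nra.
  have := mulr_ge0_le0 (sqr_ge0 rho) y1; have := sqr_ge0 (t - (q + c * y))%R.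
  by lra.
rewrite ge0_integralZl//; last 3 first.
- by apply/measurable_EFinP; exact: measurable_fun_arcsine_pdf.
- by move=> y _; rewrite lee_fin arcsine_pdf_ge0.
- by rewrite lee_fin divr_ge0// ltW.
rewrite integral_arcsine_pdf.
(* The sign of [M'] is that of [r ^+ 2 - (t - q) ^+ 2]. *)
have -> : (0 < M')%R = (t \in `](q - r)%R, (q + r)%R[%classic).
  rewrite /M' -mulrA pmulr_rgt0 ?exprn_gt0// pmulr_lgt0 ?invr_gt0 ?exprn_gt0//.
  rewrite subr_gt0 -[ltLHS]real_normK ?num_real// ltr_pXn2r ?nnegrE ?normr_ge0 ?ltW//.
  by rewrite ltr_distl; apply/idP/idP; rewrite inE/= in_itv.
rewrite [in RHS]indicE in_setI indicE.
case: (t \in `]_, _[%classic); last by rewrite mule0 mule0.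
by rewrite -!EFinM; congr EFin; rewrite /=; ring.
Qed.

(** Along the polar axis the form depends on the colatitude alone: the azimuth contributes its
    length [2 pi] and [cos_affine_law] does the rest. *)
Lemma uniform_sphere_linear_pole (c q r : R) (A : set R) : measurable A ->
  (0 < r)%R -> (c ^+ 2 = r ^+ 2)%R ->
  uniform_sphere ((fun s => q + dot (0, 0, c) s)%R @^-1` A) =
  ((2 * r)^-1)%:E * leb (`](q - r)%R, (q + r)%R[ `&` A).
Proof.
move=> mA r0 cr.
rewrite uniform_sphereE; last first.
  rewrite -[X in measurable X]setTI.
  by apply: measurable_funD => //; exact: measurable_dotl.
have rn0 : r != 0%R by rewrite gt_eqF.
have pn0 : (pi : R) != 0%R by rewrite gt_eqF// pi_gt0.
transitivity (((4 * pi)^-1)%:E * ((2 * pi / r)%:E *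
    \int[leb]_(x in (fun x => q + c * cos x)%R @^-1` A) (sin_density r x)%:E)).
  rewrite integral_mkindic -ge0_integralZl//; last 3 first.
  - apply/measurable_EFinP; apply: measurable_funM; last exact: measurable_sin_density.
    apply: measurable_indic; rewrite -[X in measurable X]setTI.
    exact: measurable_cos_affine.
  - by move=> x _; rewrite lee_fin mulr_ge0// sin_density_ge0// ltW.
  - by rewrite lee_fin divr_ge0 ?mulr_ge0 ?pi_ge0 ?ltW.
  congr (_ * _); apply: eq_integral => x _.
  rewrite indicE.
  have [/set_mem xA|xA] := boolP (x \in (fun x => q + c * cos x)%R @^-1` A).
    rewrite (_ : (fun y => _) @^-1` _ = setT); last first.
      by apply/seteqP; split => // y _; rewrite /= /preimage/= /dot/= !mul0r !add0r.
    rewrite setIT lebesgue_measure_itv/= lte_fin mulr_gt0 ?pi_gt0// -EFinB subr0.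
    rewrite mul1r -!EFinM; congr EFin; rewrite /sin_density mul1r.
    by move: pi pn0 => P pn0; field.
  rewrite (_ : (fun y => _) @^-1` _ = set0); last first.
    apply/seteqP; split => // y; rewrite /= /preimage/= /dot/= !mul0r !add0r.
    by move: xA; rewrite notin_setE.
  by rewrite setI0 measure0 mul0r !mule0.
have -> : \int[leb]_(x in (fun x => q + c * cos x)%R @^-1` A) (sin_density r x)%:E =
    leb (`](q - r)%R, (q + r)%R[ `&` A); last first.
  rewrite !muleA -!EFinM; congr (_%:E * _).
  by move: pi pn0 => P pn0; field; rewrite rn0 pn0.
have /orP[/eqP ->|/eqP ->] : (c == r) || (c == - r)%R by rewrite -eqf_sqr cr.
  exact: cos_affine_law.
(* The case [c = - r] follows from the case of a positive slope by reflecting [A]. *)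
have mN : measurable (-%R @^-1` A) by rewrite -[X in measurable X]setTI; exact: oppr_measurable.
have := cos_affine_law (- q) r0 mN.
rewrite (_ : (fun x => _) @^-1` _ = (fun x => q + - r * cos x)%R @^-1` A); last first.
  by apply/funext => x; rewrite /preimage/= opprD opprK mulNr.
move=> ->; rewrite -[RHS]lebesgue_measureN; last exact: measurableI.
rewrite /pushforward preimage_setI; congr (leb (_ `&` _)).
apply/seteqP; split => x /=; rewrite !in_itv/= => /andP[x1 x2]; apply/andP; split; lra.
Qed.

(** Archimedes' theorem for any direction: the horizontal part of [w] is put in polar form, and its
    length [rho] is either positive or 0. *)
Lemma uniform_sphere_linear (w : vec3 R) (q r : R) (A : set R) : measurable A ->
  (0 < r)%R -> (dot w w = r ^+ 2)%R ->
  uniform_sphere ((fun s => q + dot w s)%R @^-1` A) =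
  ((2 * r)^-1)%:E * leb (`](q - r)%R, (q + r)%R[ `&` A).
Proof.
case: w => [[a b] c] mA r0; rewrite /dot/= => wr.
have [rho [psi [rho0 psiI aE bE]]] := polar_coordinates a b.
have rhoc : (rho ^+ 2 + c ^+ 2 = r ^+ 2)%R.
  rewrite -wr aE bE; have := cos2Dsin2 psi => cs.
  rewrite -[X in (X + _)%R]mulr1 -cs; ring.
rewrite aE bE; move: rho0; rewrite le_eqVlt => /predU1P[rho0|rho0].
  rewrite -rho0 !mul0r; apply: uniform_sphere_linear_pole => //.
  by rewrite -rhoc -rho0 expr0n add0r.
exact: uniform_sphere_linear_neq0.
Qed.

End linear_law.

(** * The law of the energy for general couplings *)

Section phase_law.
Local Open Scope ereal_scope.
Context {R : realType}.
Local Notation leb := (@lebesgue_measure R).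
Local Notation U := (@uniform_sphere R).

Lemma measurable_unit_sphere : measurable (@unit_sphere R).
Proof.
have : measurable_fun setT (fun u : vec3 R => dot u u).
  by apply: measurable_funD; [apply: measurable_funD|]; apply: measurable_funM;
    repeat (apply: measurableT_comp => //).
by move=> /(_ measurableT [set 1%R] (measurable_set1 _)); rewrite setTI.
Qed.

(** [U] is a measure on the whole space but charges only the sphere, so identities valid for unit
    vectors may be used under the integral. *)
Lemma eq_integral_unit_sphere (F F' : vec3 R -> \bar R) :
  measurable_fun setT F -> measurable_fun setT F' ->
  (forall s, 0 <= F s) -> (forall s, 0 <= F' s) ->
  (forall s, unit_sphere s -> F s = F' s) ->
  \int[U]_s F s = \int[U]_s F' s.
Proof.
move=> mF mF' F0 F'0 FF'; apply: ge0_ae_eq_integral => //.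
exists (~` @unit_sphere R); split.
- by apply: measurableC; exact: measurable_unit_sphere.
- have := @probability_setC _ _ _ U _ measurable_unit_sphere.
  by move=> /= ->; rewrite uniform_sphere_unit_sphere subee.
- by move=> s /= + sS; apply => _; exact: FF'.
Qed.

Lemma unit_sphere_dot_le1 (u v : vec3 R) :
  unit_sphere u -> unit_sphere v -> (-1 <= dot u v <= 1)%R.
Proof.
rewrite /unit_sphere /dot/= => u1 v1.
(* These squares add up to [2 - 2 u.v] and [2 + 2 u.v]. *)
have := sqr_ge0 (u.1.1 - v.1.1); have := sqr_ge0 (u.1.2 - v.1.2).
have := sqr_ge0 (u.2 - v.2); have := sqr_ge0 (u.1.1 + v.1.1).
have := sqr_ge0 (u.1.2 + v.1.2); have := sqr_ge0 (u.2 + v.2).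
rewrite !sqrrD !sqrrN !mulrN => h1 h2 h3 h4 h5 h6.
by apply/andP; split; lra.
Qed.

(** Archimedes' theorem with [q = 0] and [r = 1], passed from sets to functions by
    [integral_transfer]. *)
Lemma integral_uniform_sphere_dot (s1 : vec3 R) (G : R -> \bar R) :
  unit_sphere s1 -> measurable_fun setT G -> (forall u, 0 <= G u) ->
  \int[U]_s G (dot s1 s) =
  \int[leb]_u (G u * (2^-1 * \1_`](-1)%R, 1%R[%classic u)%:E).
Proof.
move=> s11 mG G0.
transitivity (\int[U]_s (G (dot s1 s) * (1 : R)%:E)).
  by apply: eq_integral => s _; rewrite mule1.
apply: (@integral_transfer R _ _ _ _ U leb (dot s1) (cst 1%R)) => //.
- exact: measurable_dotl.
- by apply: measurable_funM.
- move=> A mA.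
  have mXA : measurable (dot s1 @^-1` A).
    by rewrite -[X in measurable X]setTI; exact: measurable_dotl.
  rewrite [LHS](integral_cst U mXA 1) mul1e.
  have := uniform_sphere_linear 0 mA ltr01.
  move=> /(_ s1); rewrite s11 expr1n => /(_ erefl).
  rewrite (_ : (fun s => 0 + dot s1 s)%R = dot s1); last by apply/funext => s; rewrite add0r.
  rewrite sub0r add0r mulr1 => UA; rewrite [LHS]UA.
  under [RHS]eq_integral do rewrite EFinM.
  rewrite ge0_integralZl//; last first.
    by apply/measurable_EFinP; exact: measurable_indic.
  by rewrite integral_indic.
Qed.

Section hamiltonian_law.
Variables J1 J2 J3 : R.

(** The norm of [J1 s2 + J2 s1] for unit vectors with [s1.s2 = u]. *)
Definition conditional_radius (u : R) : R :=
  Num.sqrt (J1 ^+ 2 + J2 ^+ 2 + 2 * J1 * J2 * u).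

Local Notation rad := conditional_radius.

(* The density at e of the energy, given that s1.s2 = u. *)
Definition conditional_density (u e : R) : R :=
  if (`|e - J3 * u| < rad u)%R then (2 * rad u)^-1%R else 0%R.

Local Notation cdens := conditional_density.

Let measurable_rad d (T : measurableType d) (u : T -> R) :
  measurable_fun setT u -> measurable_fun setT (fun x => rad (u x)).
Proof.
move=> mu; apply: (measurableT_comp (continuous_measurable_fun (@sqrt_continuous R))).
by apply: measurable_funD => //; exact: measurable_funM.
Qed.

Lemma measurable_conditional_density d (T : measurableType d) (u e : T -> R) :
  measurable_fun setT u -> measurable_fun setT e ->
  measurable_fun setT (fun x => cdens (u x) (e x)).
Proof.
move=> mu me; apply: measurable_fun_ifT => //.
- apply: measurable_fun_ltr; last exact: measurable_rad.
  by apply: measurableT_comp => //; apply: measurable_funB => //; exact: measurable_funM.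
- under eq_fun do rewrite invfM.
  apply: measurable_funM => //.
  apply: (measurableT_comp measurable_invr_sqrt).
  by apply: measurable_funD => //; exact: measurable_funM.
Qed.

Lemma conditional_density_ge0 u e : (0 <= cdens u e)%R.
Proof.
by rewrite /cdens; case: ifPn => // _; rewrite invr_ge0 mulr_ge0// sqrtr_ge0.
Qed.

Definition density_of_states_integral (e : R) : \bar R :=
  \int[leb]_u (2^-1 * \1_`](-1)%R, 1%R[%classic u * cdens u e)%:E.

(** The conditional probability that the energy lies in [A], given [s1.s2 = u]. *)
Let G (A : set R) (u : R) : \bar R := \int[leb]_e (\1_A e * cdens u e)%:E.

Let F (A : set R) (z : R * R) : \bar R := (\1_A z.2 * cdens z.1 z.2)%:E.

Let measurable_F A : measurable A -> measurable_fun setT (F A).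
Proof.
move=> mA; apply/measurable_EFinP; apply: measurable_funM.
  have mI : measurable_fun setT (\1_A : R -> R) by exact: measurable_indic.
  exact: (measurableT_comp mI measurable_snd).
exact: measurable_conditional_density.
Qed.

Let F_ge0 A z : 0 <= F A z.
Proof. by rewrite lee_fin mulr_ge0// conditional_density_ge0. Qed.

Let measurable_G A : measurable A -> measurable_fun setT (G A).
Proof.
move=> mA.
exact: (@measurable_fun_fubini_tonelli_F _ _ _ _ _ leb (F A) (measurable_F mA) (F_ge0 A)).
Qed.

Let G_ge0 A u : 0 <= G A u.
Proof. by apply: integral_ge0 => e _; exact: (F_ge0 A (u, e)). Qed.

Hypothesis J12 : (J1 ^+ 2 != J2 ^+ 2)%R.

(** The expression is affine in [u] and equals [(J1 - J2) ^+ 2] and [(J1 + J2) ^+ 2], both positive,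
    at the end points. *)
Lemma conditional_radius_sqr_gt0 (u : R) : (-1 <= u <= 1)%R ->
  (0 < J1 ^+ 2 + J2 ^+ 2 + 2 * J1 * J2 * u)%R.
Proof.
move=> /andP[u1 u2].
have := J12; rewrite eqf_sqr negb_or => /andP[h1 h2].
have d1 : (0 < (J1 - J2) ^+ 2)%R by rewrite exprn_even_gt0//= subr_eq0.
have d2 : (0 < (J1 + J2) ^+ 2)%R by rewrite exprn_even_gt0//= addr_eq0.
have [p|p] := leP 0%R (J1 * J2)%R; nra.
Qed.

(** With [s1] and [s2] fixed the energy is [J3 * u + dot w s3], where [w] has norm [rad u], so
    Archimedes' theorem applies. *)
Lemma conditional_law (s1 s2 : vec3 R) A : measurable A ->
  unit_sphere s1 -> unit_sphere s2 ->
  U (xsection (hamiltonian J1 J2 J3 @^-1` A) (s1, s2)) = G A (dot s1 s2).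
Proof.
move=> mA S1 S2; set u := dot s1 s2.
have uB := unit_sphere_dot_le1 S1 S2; rewrite -/u in uB.
have r2 := conditional_radius_sqr_gt0 uB.
pose lin (s2 s1 : R) := (J1 * s2 + J2 * s1)%R.
pose w : vec3 R := (lin s2.1.1 s1.1.1, lin s2.1.2 s1.1.2, lin s2.2 s1.2).
have wr : dot w w = (rad u ^+ 2)%R.
  rewrite sqr_sqrtr ?ltW//.
  transitivity (J1 ^+ 2 * dot s2 s2 + J2 ^+ 2 * dot s1 s1 + 2 * J1 * J2 * u)%R.
    by rewrite /w /lin /u /dot/=; ring.
  by rewrite [dot s1 s1]S1 [dot s2 s2]S2 !mulr1.
rewrite (_ : xsection _ _ = (fun s => J3 * u + dot w s)%R @^-1` A); last first.
  apply/funext => s; rewrite /xsection/= in_setE/= /hamiltonian/=.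
  by congr (A _); rewrite /u /w /lin /dot/=; ring.
have rp : (0 < rad u)%R by rewrite sqrtr_gt0.
rewrite [LHS](uniform_sphere_linear _ mA rp wr).
transitivity (\int[leb]_e (((2 * rad u)^-1)%:E *
    (\1_(`](J3 * u - rad u)%R, (J3 * u + rad u)%R[ `&` A) e)%:E)).
  rewrite ge0_integralZl//.
  - by rewrite integral_indic ?setIT//; exact: measurableI.
  - by apply/measurable_EFinP; apply: measurable_indic; exact: measurableI.
  - by rewrite lee_fin invr_ge0 mulr_ge0// ltW.
apply: eq_integral => e _; rewrite -EFinM; congr EFin.
rewrite !indicE in_setI /cdens ltr_distl.
have -> : (e \in `](J3 * u - rad u)%R, (J3 * u + rad u)%R[%classic) =
    (J3 * u - rad u < e < J3 * u + rad u)%R.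
  by apply/idP/idP; rewrite inE/= in_itv.
by case: ifPn => _; case: (e \in A); rewrite !(mulr0, mul0r, mul1r, mulr1).
Qed.

(** Integrate out [s3] by [conditional_law], then [s2] through [u = s1.s2]; the result is the same
    for every unit [s1], and Tonelli exchanges [u] and [e]. *)
Lemma hamiltonian_law (A : set R) : measurable A ->
  distribution (phase_probability R) (hamiltonian J1 J2 J3) A =
  \int[leb]_(e in A) density_of_states_integral e.
Proof.
move=> mA.
have mHA : measurable (hamiltonian J1 J2 J3 @^-1` A).
  by rewrite -[X in measurable X]setTI; exact: measurable_funP.
transitivity (\int[(U \x U)%E]_z U (xsection (hamiltonian J1 J2 J3 @^-1` A) z)).
  by [].
have mX := @measurable_fun_xsection _ _ _ _ _ U _ mHA.
rewrite (@fubini_tonelli1 _ _ _ _ _ U U _ mX)//.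
pose K := \int[leb]_u (G A u * (2^-1 * \1_`](-1)%R, 1%R[%classic u)%:E).
transitivity (\int[U]_s1 (cst K s1)).
  apply: eq_integral_unit_sphere => //.
  - exact: (@measurable_fun_fubini_tonelli_F _ _ _ _ _ U _ mX).
  - by move=> s1; exact: integral_ge0.
  - move=> s1; apply: integral_ge0 => u _; rewrite mule_ge0 ?G_ge0//.
  move=> s1 S1; rewrite /fubini_F /K -(integral_uniform_sphere_dot S1)//; last exact: measurable_G.
  apply: eq_integral_unit_sphere => //.
  - exact: (measurableT_comp mX (measurable_pair1 s1)).
  - apply: (measurableT_comp (measurable_G mA)); exact: measurable_dotl.
  - by move=> s2; exact: conditional_law.
rewrite integral_cst// [X in K * X](@probability_setT _ _ _ U) mule1 /K.
pose H (z : R * R) := (2^-1 * \1_`](-1)%R, 1%R[%classic z.1 *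
  (\1_A z.2 * cdens z.1 z.2))%:E.
have mH : measurable_fun setT H.
  apply/measurable_EFinP; apply: measurable_funM.
    apply: measurable_funM => //.
    have mI : measurable_fun setT (\1_`](-1)%R, 1%R[%classic : R -> R) by [].
    exact: (measurableT_comp mI measurable_fst).
  by have /measurable_EFinP := measurable_F mA.
have H0 z : 0 <= H z.
  by rewrite lee_fin !mulr_ge0// conditional_density_ge0.
transitivity (\int[leb]_u \int[leb]_e H (u, e)).
  apply: eq_integral => u _; rewrite muleC /G -ge0_integralZl//.
  - by apply/measurable_EFinP; apply: measurable_funM => //; exact: measurable_conditional_density.
  - by move=> e _; exact: (F_ge0 A (u, e)).
rewrite [LHS](@fubini_tonelli _ _ _ _ _ leb leb H mH H0) [RHS]integral_mkcond.
apply: eq_integral => e _; rewrite /H/= patchE indicE.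
case: (e \in A); last by apply: integral0_eq => u _; rewrite mul0r mulr0.
by apply: eq_integral => u _; rewrite mul1r.
Qed.

Lemma measurable_density_of_states_integral :
  measurable_fun setT density_of_states_integral.
Proof.
pose H (z : R * R) := (2^-1 * \1_`](-1)%R, 1%R[%classic z.1 * cdens z.1 z.2)%:E.
have mH : measurable_fun setT H.
  apply/measurable_EFinP; apply: measurable_funM; last first.
    exact: measurable_conditional_density.
  apply: measurable_funM => //.
  have mI : measurable_fun setT (\1_`](-1)%R, 1%R[%classic : R -> R) by [].
  exact: (measurableT_comp mI measurable_fst).
have H0 z : 0 <= H z.
  by rewrite lee_fin mulr_ge0// conditional_density_ge0.
exact: (@measurable_fun_fubini_tonelli_G _ _ _ _ _ leb H mH H0).
Qed.

End hamiltonian_law.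

End phase_law.

(** * Values of the density *)

Section density_values.
Local Open Scope ereal_scope.
Context {R : realType}.
Local Notation leb := (@lebesgue_measure R).

(** On []a, b[] the integrand is [(4 * rad u)^-1], and outside it is 0. As [rad ^+ 2] has slope
    [2 * J1 * J2], an antiderivative is [rad u / (4 * J1 * J2)]. *)
Lemma density_of_states_integral_itv (J1 J2 J3 e a b : R) :
  (J1 * J2 != 0)%R -> (J1 ^+ 2 != J2 ^+ 2)%R ->
  (-1 <= a)%R -> (a <= b)%R -> (b <= 1)%R ->
  (forall u, -1 < u < 1 ->
    (`|e - J3 * u| < conditional_radius J1 J2 u) = (a < u < b))%R ->
  density_of_states_integral J1 J2 J3 e =
  ((conditional_radius J1 J2 b - conditional_radius J1 J2 a) / (4 * J1 * J2))%:E.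
Proof.
move=> J0 J12 a1 ab b1 ueq; set rad := conditional_radius J1 J2.
have rad2_gt0 u : (a <= u <= b)%R -> (0 < J1 ^+ 2 + J2 ^+ 2 + 2 * J1 * J2 * u)%R.
  move=> /andP[au ub]; apply: conditional_radius_sqr_gt0 => //.
  by rewrite (le_trans a1)//= (le_trans ub).
have -> : density_of_states_integral J1 J2 J3 e =
    \int[leb]_(u in `]a, b[) ((4 * rad u)^-1)%:E.
  rewrite [RHS]integral_mkindic; apply: eq_integral => u _; congr EFin.
  rewrite !indicE.
  have -> : (u \in `](-1)%R, 1%R[%classic) = (-1 < u < 1)%R.
    by apply/idP/idP; rewrite inE/= in_itv.
  have -> : (u \in `]a, b[%classic) = (a < u < b)%R.
    by apply/idP/idP; rewrite inE/= in_itv.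
  have [u1|u1] := boolP (-1 < u < 1)%R.
    rewrite /conditional_density ueq//; case: ifPn => _; last by rewrite mulr0 mul0r.
    by rewrite mulr1 mul1r -invfM mulrA -natrM.
  rewrite mulr0 mul0r (_ : (a < u < b)%R = false) ?mul0r//.
  apply/negbTE; apply: contra u1 => /andP[au ub].
  by rewrite (le_lt_trans a1)//= (lt_le_trans ub).
move: ab; rewrite le_eqVlt => /predU1P[<-|ab].
  by rewrite set_itvoo0 integral_set0 subrr mul0r.
have drad u : (a <= u <= b)%R ->
    is_derive u 1%R (fun u => rad u / (4 * J1 * J2))%R ((4 * rad u)^-1)%R.
  move=> uab; have r2 := rad2_gt0 _ uab.
  have dlin : is_derive u 1%R (fun u => J1 ^+ 2 + J2 ^+ 2 + 2 * J1 * J2 * u)%R (2 * J1 * J2)%R.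
    have -> : (fun u : R => J1 ^+ 2 + J2 ^+ 2 + 2 * J1 * J2 * u)%R =
      (cst (J1 ^+ 2 + J2 ^+ 2) + (2 * J1 * J2) *: (@id R))%R by [].
    by apply: is_derive_eq; rewrite add0r /GRing.scale/= mulr1.
  pose lin (v : R) : R := (J1 ^+ 2 + J2 ^+ 2 + 2 * J1 * J2 * v)%R.
  have dsqrt : is_derive (lin u) 1%R (@Num.sqrt R) ((2 * Num.sqrt (lin u))^-1)%R.
    exact: is_derive1_sqrt.
  have dsq := @is_derive1_comp _ (@Num.sqrt R) lin u _ _ dsqrt dlin.
  have -> : (fun u => rad u / (4 * J1 * J2))%R =
      ((4 * J1 * J2)^-1 *: (@Num.sqrt R \o lin))%R.
    by apply/funext => v; rewrite mulrC.
  apply: is_derive_eq; rewrite /GRing.scale/=.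
  have s0 : rad u != 0%R by rewrite gt_eqF// sqrtr_gt0.
  rewrite -[Num.sqrt (lin u)]/(rad u); move: J0; rewrite mulf_eq0 negb_or => /andP[J10 J20].
  by move: (rad u) s0 => x s0; field; rewrite J10 J20 s0.
have crad u : (a <= u <= b)%R -> {for u, continuous (fun u => rad u / (4 * J1 * J2))%R}.
  by move=> uab; apply/differentiable_continuous/derivable1_diffP; case: (drad u uab).
have aab : (a <= a <= b)%R by rewrite lexx ltW.
have bab : (a <= b <= b)%R by rewrite lexx ltW.
have cinv : {within `[a, b], continuous (fun u => (4 * rad u)^-1)%R}.
  apply: continuous_in_subspaceT => u; rewrite inE/= in_itv/= => uab.
  apply: (@continuousV _ _ (fun v => 4 * rad v)%R).
    by rewrite mulf_neq0// gt_eqF// sqrtr_gt0 rad2_gt0.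
  apply: continuousM; first exact: cst_continuous.
  have -> : rad = (@Num.sqrt R \o (fun u => J1 ^+ 2 + J2 ^+ 2 + 2 * J1 * J2 * u))%R by [].
  apply: continuous_comp; last exact: sqrt_continuous.
  apply: continuousD; first exact: cst_continuous.
  by apply: continuousM; [exact: cst_continuous|exact: cvg_id].
rewrite -(@integral_itv_bndoo _ _ _ _ true false); last first.
  apply/measurable_EFinP.
  apply: (measurable_funS (measurable_itv `[a, b])); first exact: subset_itv_oo_cc.
  exact: subspace_continuous_measurable_fun.
rewrite (@continuous_FTC2 _ _ (fun u => rad u / (4 * J1 * J2))%R)//.
- by rewrite -EFinB -mulrBl.
- split.
  + by move=> u; rewrite in_itv/= => /andP[/ltW au /ltW ub]; case: (drad u _) => //; rewrite au.
  + exact/cvg_at_right_filter/crad.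
  + exact/cvg_at_left_filter/crad.
- move=> u; rewrite in_itv/= => /andP[/ltW au /ltW ub]; rewrite derive1E.
  by case: (drad u _) => //; rewrite au.
Qed.

End density_values.

(** * The couplings of the theorem: interval lengths and roots of the quadratics *)

Section special_couplings.
Context {R : realType}.
Local Notation s := (Num.sqrt (2 : R)).

Let s2 : s ^+ 2 = 2.
Proof. by rewrite sqr_sqrtr. Qed.

Lemma sqrt2_gt : 7 / 5 < s.
Proof. by have := s2; have := sqrtr_ge0 (2 : R); nra. Qed.

Lemma sqrt2_lt : s < 10 / 7.
Proof. by have := s2; have := sqrtr_ge0 (2 : R); nra. Qed.

Local Notation J1 := (- (1 / 2) : R).
Local Notation J2 := (1 / 2 + s / 2).
Local Notation J3 := (s / 2).
Local Notation rad := (conditional_radius J1 J2).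
Local Notation lo := (s / 2).
Local Notation hi := (1 + s / 2).
Local Notation dos := (density_of_states_integral J1 J2 J3).

Let rad2E u : J1 ^+ 2 + J2 ^+ 2 + 2 * J1 * J2 * u = 1 + s / 2 - (1 + s) / 2 * u.
Proof. by field: s2. Qed.

Lemma special_couplings_sqr_neq : J1 ^+ 2 != J2 ^+ 2.
Proof. by have := sqrt2_gt => sg; rewrite lt_eqF//; nra. Qed.

(** The inverse of [rad], using [2 / (1 + s) = 2 * (s - 1)]. *)
Let U (r : R) : R := (1 + s / 2 - r ^+ 2) * (2 * (s - 1)).

Let radU r : 0 <= r -> rad (U r) = r.
Proof.
move=> r0; rewrite /conditional_radius rad2E /U.
by rewrite (_ : _ - _ = r ^+ 2) ?sqrtr_sqr ?ger0_norm//; field: s2.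
Qed.

(* In the variable r = |J1 s2 + J2 s1|, which decreases from hi to lo as u = s1.s2
   increases from -1 to 1, one has J3 u = 1 - (2 - sqrt 2) r^2, and the density of
   states becomes (sqrt 2 - 1) times the length of an interval. *)
Lemma density_of_states_length e r1 r2 :
  lo <= r1 -> r1 <= r2 -> r2 <= hi ->
  (forall r, lo < r -> r < hi ->
    (`|e - 1 + (2 - s) * r ^+ 2| < r) = (r1 < r < r2)) ->
  dos e = ((s - 1) * (r2 - r1))%:E.
Proof.
move=> r1lo r12 r2hi req.
have := sqrt2_gt; have := sqrt2_lt; have := s2 => ss sl sg.
have r10 : 0 <= r1 by lra.
have r20 : 0 <= r2 by lra.
have JJ : J1 * J2 != 0 by rewrite lt_eqF//; nra.
(* [U] is decreasing, so the end points swap. *)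
rewrite (@density_of_states_integral_itv _ _ _ _ _ (U r2) (U r1))//.
- congr EFin; rewrite !radU//.
  have c0 : 4 * J1 * J2 = - (1 + s) by field.
  rewrite c0; have : 1 + s != 0 by rewrite gt_eqF//; lra.
  by move=> ?; apply/eqP; rewrite invrN mulrN -mulNr opprB eq_sym; apply/eqP; field: s2.
- exact: special_couplings_sqr_neq.
- by rewrite /U; nra.
- by rewrite /U; nra.
- by rewrite /U; nra.
- move=> u /andP[u1 u2].
  have rp : 0 < J1 ^+ 2 + J2 ^+ 2 + 2 * J1 * J2 * u.
    by rewrite rad2E; nra.
  have rr : rad u ^+ 2 = 1 + s / 2 - (1 + s) / 2 * u by rewrite sqr_sqrtr ?ltW// rad2E.
  have r0 : 0 < rad u by rewrite sqrtr_gt0.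
  have -> : e - s / 2 * u = e - 1 + (2 - s) * rad u ^+ 2.
    by rewrite rr; field: s2.
  rewrite req; [|nra|nra].
  have -> : (r1 < rad u) = (u < U r1).
    rewrite -(@ltr_pXn2r _ 2) ?nnegrE ?(ltW r0)// rr /U.
    by apply/idP/idP => ?; nra.
  have -> : (rad u < r2) = (U r2 < u).
    rewrite -(@ltr_pXn2r _ 2) ?nnegrE ?(ltW r0)// rr /U.
    by apply/idP/idP => ?; nra.
  by rewrite andbC.
Qed.

Local Notation E4 := (1 / 8 * (10 + s)).
Local Notation q := (Num.sqrt (2 + s)).
Local Notation a := ((2 + s) / 4).

(* The roots of (2 - sqrt 2) r^2 - r + e - 1 are a - b e and a + b e, those of
   (2 - sqrt 2) r^2 + r + e - 1 are their opposites. *)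
Let b (e : R) : R := s * q * Num.sqrt (E4 - e) / 2.

Let b_ge0 e : 0 <= b e.
Proof. by rewrite /b !mulr_ge0 ?sqrtr_ge0. Qed.

Let q2 : q ^+ 2 = 2 + s.
Proof. by rewrite sqr_sqrtr// addr_ge0 ?sqrtr_ge0. Qed.

Let q_gt0 : 0 < q.
Proof. by rewrite sqrtr_gt0 addr_gt0// sqrtr_gt0. Qed.

Let b2 e : e <= E4 -> b e ^+ 2 = (2 + s) / 2 * (E4 - e).
Proof.
move=> eE; have T2 : Num.sqrt (E4 - e) ^+ 2 = E4 - e by rewrite sqr_sqrtr// subr_ge0.
by rewrite /b !exprMn T2 q2 s2; field.
Qed.

(** Turns [s - 1] times a length involving [b e] into the square roots of the stated density. *)
Let bE e : (s - 1) * b e = Num.sqrt (E4 - e) / q.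
Proof.
rewrite /b; have qn0 : q != 0 by rewrite gt_eqF.
apply: (mulIf qn0); rewrite divfK//.
transitivity ((s - 1) * s * q ^+ 2 / 2 * Num.sqrt (E4 - e)); first by ring.
by rewrite q2; field: s2.
Qed.

(** Completing the square: the difference of the two sides is [2 - s] times
    [b e ^+ 2 - (r - a) ^+ 2]. *)
Let upperE e r : e <= E4 -> 0 < r ->
  (e - 1 + (2 - s) * r ^+ 2 < r) = (a - b e < r < a + b e).
Proof.
move=> eE r0; have := sqrt2_lt; have := s2 => ss sl.
rewrite -ltr_distl -[RHS](@ltr_pXn2r _ 2%N) ?nnegrE// real_normK ?num_real// b2//.
have h : r - (e - 1 + (2 - s) * r ^+ 2) = (2 - s) * ((2 + s) / 2 * (E4 - e) - (r - a) ^+ 2).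
  by field: s2.
by rewrite -[LHS]subr_gt0 h pmulr_rgt0 ?subr_gt0//; lra.
Qed.

(** Here the difference is [2 - s] times [(r + a) ^+ 2 - b e ^+ 2], and [r + a] is positive. *)
Let lowerE e r : e <= E4 -> 0 < r ->
  (- r < e - 1 + (2 - s) * r ^+ 2) = (b e - a < r).
Proof.
move=> eE r0; have := sqrt2_lt; have := sqrt2_gt; have := s2 => ss sg sl.
rewrite [RHS]ltrBlDr -[RHS](@ltr_pXn2r _ 2%N) ?nnegrE//; last by lra.
have h : e - 1 + (2 - s) * r ^+ 2 - - r = (2 - s) * ((r + a) ^+ 2 - (2 + s) / 2 * (E4 - e)).
  by field: s2.
by rewrite b2// -[LHS]subr_gt0 h pmulr_rgt0 ?subr_gt0//; lra.
Qed.

Let energyE e r : e <= E4 -> 0 < r ->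
  (`|e - 1 + (2 - s) * r ^+ 2| < r) = (b e - a < r) && (a - b e < r < a + b e).
Proof. by move=> eE r0; rewrite ltr_norml lowerE// upperE. Qed.

Lemma density_of_states_gt e : E4 < e -> dos e = 0%E.
Proof.
have := sqrt2_lt; have := sqrt2_gt; have := s2 => ss sg sl eE.
(* The empty set of radii is presented as the degenerate interval from [lo] to [lo]. *)
rewrite (@density_of_states_length e lo lo) ?subrr ?mulr0//; first by lra.
move=> r rlo rhi; rewrite [RHS](_ : _ = false); last first.
  by apply/negbTE; rewrite negb_and -!leNgt; apply/orP; right; lra.
apply/negbTE; rewrite -leNgt ler_normr; apply/orP; left.
by have := sqr_ge0 (r - a); nra.
Qed.

(** At [r = hi] the quadratic [(2 - s) r^2 + r + e - 1] equals [e + 1 + s < 0]; it increases for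
    [r > 0], so it is negative on the whole range. *)
Lemma density_of_states_lt e : e < - 1 - s -> dos e = 0%E.
Proof.
have := sqrt2_lt; have := sqrt2_gt; have := s2 => ss sg sl eE.
rewrite (@density_of_states_length e lo lo) ?subrr ?mulr0//; first by lra.
move=> r rlo rhi; rewrite [RHS](_ : _ = false); last first.
  by apply/negbTE; rewrite negb_and -!leNgt; apply/orP; right; lra.
apply/negbTE; rewrite -leNgt ler_normr; apply/orP; right.
by nra.
Qed.

Let le_b e x : e <= E4 -> x ^+ 2 <= (2 + s) / 2 * (E4 - e) -> x <= b e.
Proof.
move=> eE; rewrite -b2// => h.
by have [x0|x0] := ltP x 0; [exact: le_trans (ltW x0) _|rewrite -(@ler_pXn2r _ 2%N) ?nnegrE].
Qed.

Let ge_b e x : e <= E4 -> 0 <= x -> (2 + s) / 2 * (E4 - e) <= x ^+ 2 -> b e <= x.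
Proof. by move=> eE x0; rewrite -b2// ler_pXn2r ?nnegrE//. Qed.

Lemma density_of_states_01 e : - 1 - s <= e -> e <= 0 ->
  dos e = (3 / (2 * s) - Num.sqrt (E4 - e) / q)%:E.
Proof.
have := sqrt2_lt; have := sqrt2_gt; have := s2 => ss sg sl e1 e2.
have eE : e <= E4 by lra.
(* The bounds are [lo + a] and [hi + a]: the root [b e - a] moves from [hi] at [E0] to [lo] at
   [E1]. *)
have h1 : (3 * s + 2) / 4 <= b e by apply: le_b => //; nra.
have h2 : b e <= (6 + 3 * s) / 4 by apply: ge_b => //; nra.
rewrite (@density_of_states_length e (b e - a) hi); [| lra..|].
  congr EFin; rewrite -bE.
  have sn0 : s != 0 by rewrite gt_eqF//; lra.
  by field: s2.
move=> r rlo rhi; rewrite energyE//; last by lra.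
by rewrite rhi andbT; case: (b e - a < r) => //=; apply/andP; split; lra.
Qed.

Lemma density_of_states_12 e : 0 <= e -> e <= 1 -> dos e = (s - 1)%:E.
Proof.
have := sqrt2_lt; have := sqrt2_gt; have := s2 => ss sg sl e1 e2.
have eE : e <= E4 by lra.
have h1 : b e <= (3 * s + 2) / 4 by apply: ge_b => //; nra.
(* This bound is [hi - a], so [a + b e] is still at least [hi]; together with [h1], every radius in
   the range is allowed. *)
have h2 : (2 + s) / 4 <= b e by apply: le_b => //; nra.
rewrite (@density_of_states_length e lo hi); [| lra..|].
  by congr EFin; field.
move=> r rlo rhi; rewrite energyE//; last by lra.
rewrite rlo rhi; apply/andP; split; first by lra.
by apply/andP; split; lra.
Qed.

Lemma density_of_states_23 e : 1 <= e -> e <= s ->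
  dos e = (Num.sqrt (E4 - e) / q + 3 / (2 * s) - 1)%:E.
Proof.
have := sqrt2_lt; have := sqrt2_gt; have := s2 => ss sg sl e1 e2.
have eE : e <= E4 by lra.
(* The bounds are [hi - a] and [a - lo]: [a + b e] has entered the range, reaching [hi] at [E2],
   while [a - b e] is still at most [lo]. *)
have h1 : b e <= (2 + s) / 4 by apply: ge_b => //; nra.
have h2 : (2 - s) / 4 <= b e by apply: le_b => //; nra.
rewrite (@density_of_states_length e lo (a + b e)); [| lra..|].
  congr EFin; rewrite -bE.
  have sn0 : s != 0 by rewrite gt_eqF//; lra.
  by field: s2.
move=> r rlo rhi; rewrite energyE//; last by lra.
rewrite rlo (_ : (b e - a < r) = true) /=; last by lra.
by rewrite (_ : (a - b e < r) = true) //; lra.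
Qed.

Lemma density_of_states_34 e : s <= e -> e <= E4 ->
  dos e = (Num.sqrt (4 - 2 * s) * Num.sqrt (E4 - e))%:E.
Proof.
have := sqrt2_lt; have := sqrt2_gt; have := s2 => ss sg sl e1 eE.
(* Now [b e <= a - lo], so both roots [a - b e] and [a + b e] lie in the range; they merge at
   [E4]. *)
have h1 : b e <= (2 - s) / 4 by apply: ge_b => //; nra.
have b0 := b_ge0 e.
rewrite (@density_of_states_length e (a - b e) (a + b e)); [| lra..|].
  congr EFin; transitivity (2 * ((s - 1) * b e)); first by ring.
  (* This rests on [(4 - 2 s) (2 + s) = 4]. *)
  rewrite bE; have -> : Num.sqrt (4 - 2 * s) = 2 / q.
    rewrite -[RHS]ger0_norm; last by rewrite divr_ge0 ?sqrtr_ge0.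
    rewrite -sqrtr_sqr; congr Num.sqrt; rewrite expr_div_n q2.
    have qn0 : 2 + s != 0 by rewrite gt_eqF//; lra.
    by apply: (mulIf qn0); rewrite divfK//; ring: s2.
  by ring.
move=> r rlo rhi; rewrite energyE//; last by lra.
by rewrite (_ : (b e - a < r) = true) //; lra.
Qed.

End special_couplings.

(** * Assembling the density of states from its pieces *)

Theorem mainTheorem2 (R : realType) (J1 J2 J3 E0 E1 E2 E3 E4 : R)
  (hJ1 : J1 = - (1 / 2))
  (hJ2 : J2 = 1 / 2 + Num.sqrt 2 / 2)
  (hJ3 : J3 = Num.sqrt 2 / 2)
  (hE0 : E0 = - 1 - Num.sqrt 2)
  (hE1 : E1 = 0)
  (hE2 : E2 = 1)
  (hE3 : E3 = Num.sqrt 2)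
  (hE4 : E4 = 1 / 8 * (10 + Num.sqrt 2)) :
  exists D : R -> R,
    is_density_of_states J1 J2 J3 D /\
    (forall e, ~ (E0 <= e <= E4) -> D e = 0) /\
    (forall e, E0 <= e <= E1 ->
       D e = 3 / (2 * Num.sqrt 2)
             - Num.sqrt (1 / 8 * (10 + Num.sqrt 2) - e) / Num.sqrt (2 + Num.sqrt 2)) /\
    (forall e, E1 <= e <= E2 -> D e = Num.sqrt 2 - 1) /\
    (forall e, E2 <= e <= E3 ->
       D e = Num.sqrt (1 / 8 * (10 + Num.sqrt 2) - e) / Num.sqrt (2 + Num.sqrt 2)
             + 3 / (2 * Num.sqrt 2) - 1) /\
    (forall e, E3 <= e <= E4 ->
       D e = Num.sqrt (4 - 2 * Num.sqrt 2)
             * Num.sqrt (1 / 8 * (10 + Num.sqrt 2) - e)).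
Proof.
pose dos e := density_of_states_integral J1 J2 J3 e.
have out e : ~ (E0 <= e <= E4) -> dos e = 0%E.
  move=> /negP; rewrite negb_and -!ltNge /dos hJ1 hJ2 hJ3 hE0 hE4 => /orP[|].
    exact: density_of_states_lt.
  exact: density_of_states_gt.
have v01 e : E0 <= e <= E1 -> dos e = (3 / (2 * Num.sqrt 2)
    - Num.sqrt (1 / 8 * (10 + Num.sqrt 2) - e) / Num.sqrt (2 + Num.sqrt 2))%:E.
  rewrite /dos hJ1 hJ2 hJ3 hE0 hE1 => /andP[h1 h2].
  exact: density_of_states_01.
have v12 e : E1 <= e <= E2 -> dos e = (Num.sqrt 2 - 1)%:E.
  rewrite /dos hJ1 hJ2 hJ3 hE1 hE2 => /andP[h1 h2].
  exact: density_of_states_12.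
have v23 e : E2 <= e <= E3 -> dos e =
    (Num.sqrt (1 / 8 * (10 + Num.sqrt 2) - e) / Num.sqrt (2 + Num.sqrt 2)
     + 3 / (2 * Num.sqrt 2) - 1)%:E.
  rewrite /dos hJ1 hJ2 hJ3 hE2 hE3 => /andP[h1 h2].
  exact: density_of_states_23.
have v34 e : E3 <= e <= E4 -> dos e = (Num.sqrt (4 - 2 * Num.sqrt 2)
    * Num.sqrt (1 / 8 * (10 + Num.sqrt 2) - e))%:E.
  rewrite /dos hJ1 hJ2 hJ3 hE3 hE4 => /andP[h1 h2].
  exact: density_of_states_34.
(* The explicit values show that the integral is finite at every energy, so [fine] yields a
   real-valued density without altering it. *)
have dos_fin e : (fine (dos e))%:E = dos e.
  apply: fineK; have [eE|/negP/out ->//] := boolP (E0 <= e <= E4).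
  move: eE => /andP[e0 e4].
  have [e1|/ltW e1] := leP e E1; first by rewrite v01 ?e0.
  have [e2|/ltW e2] := leP e E2; first by rewrite v12 ?e1.
  have [e3|/ltW e3] := leP e E3; first by rewrite v23 ?e2.
  by rewrite v34 ?e3.
exists (fun e => fine (dos e)); split; last first.
  split; [by move=> e /out ->|split; [by move=> e /v01 ->|]].
  split; [by move=> e /v12 ->|split; [by move=> e /v23 ->|]].
  by move=> e /v34 ->.
split.
- apply: (measurableT_comp (@fine_measurable _ _ measurableT)).
  exact: measurable_density_of_states_integral.
- move=> e; rewrite fine_ge0// integral_ge0// => u _.
  by rewrite lee_fin mulr_ge0// conditional_density_ge0.
- move=> A mA; rewrite hamiltonian_law//.
    by apply: eq_integral => e _; rewrite dos_fin.
  by rewrite hJ1 hJ2 special_couplings_sqr_neq.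
Qed.
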